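(* Let $R$ be an associative ring with identity and $n\ge 1$. (1) If $M\in\mathrm{Mod}\,R$ is $n$-SG-flat, then $M^+\in\mathrm{Mod}\,R^{op}$ is $n$-SG-injective. (2) If $R$ is an Artinian algebra and $M\in\mathrm{Mod}\,R$ is $n$-SG-injective, then $M^+\in\mathrm{Mod}\,R^{op}$ is $n$-SG-flat.
   Context: $\mathrm{Mod}\,R$ (resp. $\mathrm{Mod}\,R^{op}$) is the category of left (resp. right) $R$-modules. For a module $M$, $M^+=\mathrm{Hom}_{\mathbb{Z}}(M,\mathbb{Q}/\mathbb{Z})$ is its character module, with the induced module structure on the opposite side. An Artinian algebra (Artin algebra) is an algebra over a commutative Artinian ring which is finitely generated as a module over that ring. For a positive integer $n$, a left $R$-module $M$ is called $n$-strongly Gorenstein flat ($n$-SG-flat) if there exists an exact sequence of left $R$-modules $0\to M\to F_{n-1}\to\cdots\to F_0\to M\to 0$ with all $F_i$ flat, which remains exact after applying $I\otimes_R-$ for every injective right $R$-module $I$. A left $R$-module $M$ is called $n$-strongly Gorenstein injective ($n$-SG-injective) if there exists an exact sequence of left $R$-modules $0\to M\to I^{n-1}\to\cdots\to I^0\to M\to 0$ with all $I^i$ injective, which remains exact after applying $\mathrm{Hom}_R(E,-)$ for every injective left $R$-module $E$. The definitions for right $R$-modules are obtained by replacing $R$ with $R^{op}$. *)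

(* Defs.v *)
From HB Require Import structures.
From mathcomp Require Import all_boot all_algebra.
From mathcomp Require Import boolp classical_sets.
From mathcomp Require Import freeg.

Set Implicit Arguments.
Unset Strict Implicit.
Unset Printing Implicit Defensive.

Import GRing.Theory.
Local Open Scope ring_scope.
Local Open Scope quotient_scope.

(* Rings are unital, not necessarily commutative, possibly zero.  A left
   R-module is an [lmodType R]; a right R-module is an [lmodType R^c], where
   [R^c] is the opposite ring, so that [r *: x] stands for [x r]. *)

Definition exact_at (A B : Type) (C : zmodType) (f : A -> B) (g : B -> C) :=
  forall y, g y = 0 <-> exists x, f x = y.

Section Hom.
Variables (R : pzRingType) (E X : lmodType R).

Definition Hom := {linear E -> X}.

Lemma HomP (f g : Hom) : (forall x, f x = g x) -> f = g.
Proof.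
case: f g => f [[fm] [fs]] [g [[gm] [gs]]] /= /funext fg.
case: _ / fg in gm gs *.
by rewrite (Prop_irrelevance fm gm) (Prop_irrelevance fs gs).
Qed.

HB.instance Definition _ := gen_eqMixin Hom.
HB.instance Definition _ := gen_choiceMixin Hom.

Definition Hom_zero : Hom := (\0 : E -> X).
Definition Hom_add (f g : Hom) : Hom := f \+ g.
Definition Hom_opp (f : Hom) : Hom := \- f.

Fact Hom_addA : associative Hom_add.
Proof. by move=> f g h; apply: HomP => x /=; rewrite addrA. Qed.
Fact Hom_addC : commutative Hom_add.
Proof. by move=> f g; apply: HomP => x /=; rewrite addrC. Qed.
Fact Hom_add0 : left_id Hom_zero Hom_add.
Proof. by move=> f; apply: HomP => x /=; rewrite add0r. Qed.
Fact Hom_addN : left_inverse Hom_zero Hom_opp Hom_add.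
Proof. by move=> f; apply: HomP => x /=; rewrite addNr. Qed.

HB.instance Definition _ :=
  GRing.isZmodule.Build Hom Hom_addA Hom_addC Hom_add0 Hom_addN.

End Hom.

Definition Hom_map (R : pzRingType) (E X Y : lmodType R) (f : {linear X -> Y})
  (h : Hom E X) : Hom E Y := f \o h.

Definition QmodZ : Type := Quotient.quot (GRing.ZmodClosed.clone rat Num.int_num_subdef _).
HB.instance Definition _ := GRing.Zmodule.on QmodZ.

Section Character.
Variables (R : pzRingType) (M : lmodType R).

Definition char := {additive M -> QmodZ}.

Lemma charP (f g : char) : (forall x, f x = g x) -> f = g.
Proof.
case: f g => f [[fm]] [g [[gm]]] /= /funext fg.
by case: _ / fg in gm *; rewrite (Prop_irrelevance fm gm).
Qed.

HB.instance Definition _ := gen_eqMixin char.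
HB.instance Definition _ := gen_choiceMixin char.

Definition char_zero : char := (\0 : M -> QmodZ).
Definition char_add (f g : char) : char := f \+ g.
Definition char_opp (f : char) : char := \- f.

Fact char_addA : associative char_add.
Proof. by move=> f g h; apply: charP => x /=; rewrite addrA. Qed.
Fact char_addC : commutative char_add.
Proof. by move=> f g; apply: charP => x /=; rewrite addrC. Qed.
Fact char_add0 : left_id char_zero char_add.
Proof. by move=> f; apply: charP => x /=; rewrite add0r. Qed.
Fact char_addN : left_inverse char_zero char_opp char_add.
Proof. by move=> f; apply: charP => x /=; rewrite addNr. Qed.

HB.instance Definition _ :=
  GRing.isZmodule.Build char char_addA char_addC char_add0 char_addN.

(* (f r)(x) = f (r x) *)
Definition char_scale (r : R^c) (f : char) : char := f \o ( *:%R (r : R)).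

Fact char_scaleA r s f : char_scale r (char_scale s f) = char_scale (r * s) f.
Proof. by apply: charP => x /=; rewrite scalerA. Qed.
Fact char_scale1 : left_id 1 char_scale.
Proof. by move=> f; apply: charP => x /=; rewrite scale1r. Qed.
Fact char_scaleDr : right_distributive char_scale +%R.
Proof. by move=> r f g; apply: charP. Qed.
Fact char_scaleDl f : {morph char_scale^~ f : r s / r + s}.
Proof. by move=> r s; apply: charP => x /=; rewrite scalerDl raddfD. Qed.

HB.instance Definition _ := GRing.Zmodule_isLmodule.Build R^c char
  char_scaleA char_scale1 char_scaleDr char_scaleDl.

End Character.

Section Tensor.
Variables (R : pzRingType) (X : lmodType R^c) (M : lmodType R).

(* The subgroup of the free abelian group on X * M generated by the
   biadditivity and balancing relations. *)
Inductive tens_rel : {freeg (X * M) / int} -> Prop :=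
| tens_rel_addl x y m : tens_rel (<<(x + y, m)>> - (<<(x, m)>> + <<(y, m)>>))
| tens_rel_addr x m p : tens_rel (<<(x, m + p)>> - (<<(x, m)>> + <<(x, p)>>))
| tens_rel_scale (r : R) x m :
    tens_rel (<<((r : R^c) *: x, m)>> - <<(x, r *: m)>>)
| tens_rel0 : tens_rel 0
| tens_relB u v : tens_rel u -> tens_rel v -> tens_rel (u - v).

Definition tens_relb : pred {freeg (X * M) / int} := fun u => `[< tens_rel u >].

Fact tens_relb_closed : zmod_closed tens_relb.
Proof.
split; first exact/asboolP/tens_rel0.
by move=> u v /asboolP ru /asboolP rv; apply/asboolP/tens_relB.
Qed.

HB.instance Definition _ := GRing.isZmodClosed.Build _ tens_relb
  tens_relb_closed.

Definition tens_relc : zmodClosed {freeg (X * M) / int} :=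
  GRing.ZmodClosed.clone _ tens_relb _.

Definition tens : Type := Quotient.quot tens_relc.
HB.instance Definition _ := GRing.Zmodule.on tens.

Definition tens_pi (u : {freeg (X * M) / int}) : tens :=
  \pi_(Quotient.quot tens_relc) u.

Definition pure (x : X) (m : M) : tens := tens_pi <<(x, m)>>.

Definition balanced (B : zmodType) (b : X -> M -> B) :=
  [/\ forall x y m, b (x + y) m = b x m + b y m,
      forall x m p, b x (m + p) = b x m + b x p &
      forall (r : R) x m, b ((r : R^c) *: x) m = b x (r *: m)].

(* The additive map induced by a balanced map b; junk when b is not balanced. *)
Definition tens_lift (B : zmodType) (b : X -> M -> B) (t : tens) : B :=
  fglift (fun xm => b xm.1 xm.2 : zmodule B)
    (repr (t : Quotient.quot tens_relc)).

Lemma tens_pi_additive : zmod_morphism tens_pi.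
Proof. by move=> u v; rewrite /tens_pi !piE. Qed.

Lemma tens_pi_eq u v : tens_rel (u - v) <-> tens_pi u = tens_pi v.
Proof.
rewrite /tens_pi; split=> [r|/eqP].
  by apply/eqP; rewrite piE Quotient.equivE; apply/asboolP.
by rewrite piE Quotient.equivE => /asboolP.
Qed.

HB.instance Definition _ :=
  GRing.isZmodMorphism.Build _ _ tens_pi tens_pi_additive.

Lemma pure_balanced : balanced pure.
Proof.
by split=> *; rewrite /pure -?raddfD /=; apply/tens_pi_eq; constructor.
Qed.

Lemma tens_ext (B : zmodType) (f g : {additive tens -> B}) :
  (forall x m, f (pure x m) = g (pure x m)) -> f =1 g.
Proof.
move=> fg t; have [u ->] : exists u, t = tens_pi u.
  by exists (repr (t : Quotient.quot tens_relc)); rewrite /tens_pi reprK.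
rewrite -[u]freeg_sumE !raddf_sum; apply: eq_bigr => -[x m] _ /=.
have -> k : << k *g (x, m) >> = << (x, m) >> *~ k :> {freeg (X * M) / int}.
  by rewrite freegU_mulz intz.
by rewrite !raddfMz -/(pure x m) fg.
Qed.

Section Lift.
Variables (B : zmodType) (b : X -> M -> B).
Hypothesis b_bal : balanced b.
Let fb := fglift (fun xm : X * M => b xm.1 xm.2 : zmodule B).

#[local] HB.instance Definition _ :=
  GRing.isZmodMorphism.Build _ _ fb (lift_is_additive _).

Fact tens_lift_rel u : tens_rel u -> fb u = 0.
Proof.
have fbU x m : fb << (x, m) >> = b x m by rewrite /fb liftU scale1r.
case: b_bal => bl br bs.
elim=> [x y m|x m p|r x m||{}u v _ fu _ fv].
- by rewrite raddfB raddfD /= !fbU bl; apply: subrr.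
- by rewrite raddfB raddfD /= !fbU br; apply: subrr.
- by rewrite raddfB /= !fbU bs; apply: subrr.
- exact: raddf0.
- by rewrite raddfB /= fu fv; apply: subr0.
Qed.

Lemma tens_liftE u : tens_lift b (tens_pi u) = fb u.
Proof.
apply/eqP; rewrite -subr_eq0 /tens_lift -/fb.
have /tens_lift_rel : tens_rel (repr (tens_pi u : Quotient.quot tens_relc) - u).
  by apply/tens_pi_eq; rewrite /tens_pi reprK.
by rewrite raddfB => ->.
Qed.

Lemma tens_lift_pure x m : tens_lift b (pure x m) = b x m.
Proof. by rewrite tens_liftE /fb liftU scale1r. Qed.

Lemma tens_lift_additive : zmod_morphism (tens_lift b).
Proof.
move=> s t.
have [u ->] : exists u, s = tens_pi u.
  by exists (repr (s : Quotient.quot tens_relc)); rewrite /tens_pi reprK.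
have [v ->] : exists v, t = tens_pi v.
  by exists (repr (t : Quotient.quot tens_relc)); rewrite /tens_pi reprK.
by rewrite -raddfB !tens_liftE raddfB.
Qed.

End Lift.
End Tensor.

Arguments pure {R X M} x m.

Section TensorMap.
Variables (R : pzRingType) (X Y : lmodType R^c) (M N : lmodType R).
Variables (f : {linear X -> Y}) (g : {linear M -> N}).

Definition tens_map : tens X M -> tens Y N :=
  tens_lift (fun x m => pure (f x) (g m)).

Fact tens_map_balanced : balanced (fun x m => pure (f x) (g m) : tens Y N).
Proof.
have [pl pr ps] := pure_balanced Y N.
by split=> *; rewrite ?raddfD ?linearZ ?pl ?pr ?ps.
Qed.

Lemma tens_map_pure x m : tens_map (pure x m) = pure (f x) (g m).
Proof. exact: tens_lift_pure tens_map_balanced _ _. Qed.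

HB.instance Definition _ := GRing.isZmodMorphism.Build _ _ tens_map
  (tens_lift_additive tens_map_balanced).

End TensorMap.

Definition injective_module (R : pzRingType) (E : lmodType R) : Prop :=
  forall (A B : lmodType R) (i : {linear A -> B}) (f : {linear A -> E}),
    injective i -> exists g : {linear B -> E}, forall x, g (i x) = f x.

Definition flat_module (R : pzRingType) (F : lmodType R) : Prop :=
  forall (A B C : lmodType R^c) (f : {linear A -> B}) (g : {linear B -> C}),
    exact_at f g ->
    exact_at (tens_map f (@idfun F : {linear F -> F}))
             (tens_map g (@idfun F : {linear F -> F})).

(* Exactness of 0 -> L -> X_(m+1) -> X_m -> ... -> X_0 -> 0. *)
Definition exact_down (m : nat) (L : Type) (X : nat -> zmodType)
    (iota : L -> X m.+1) (d : forall i, X i.+1 -> X i) : Prop :=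
  [/\ injective iota,
      exact_at iota (d m),
      forall i, (i < m)%N -> exact_at (d i.+1) (d i) &
      forall y, exists x, d 0%N x = y].

(* Exactness of 0 -> X_0 -> X_1 -> ... -> X_(m+1) -> L -> 0. *)
Definition exact_up (m : nat) (L : zmodType) (X : nat -> zmodType)
    (d : forall i, X i -> X i.+1) (p : X m.+1 -> L) : Prop :=
  [/\ injective (d 0%N),
      forall i, (i < m)%N -> exact_at (d i) (d i.+1),
      exact_at (d m) p &
      forall y, exists x, p x = y].

(* The sequence of modules M, F_0, F_1, ... *)
Definition augment (T : Type) (M : T) (F : nat -> T) (i : nat) : T :=
  if i is j.+1 then F j else M.

(* In the sequence 0 -> M -> F_(n-1) -> ... -> F_0 -> M -> 0, the map d 0 goes
   from F_0 to M and d i from F_i to F_(i-1); F i and d i are irrelevant for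
   i >= n.  The notion is only meant for n >= 1. *)
Definition SG_flat (R : pzRingType) (n : nat) (M : lmodType R) : Prop :=
  if n is m.+1 then
    exists (F : nat -> lmodType R)
           (iota : {linear M -> augment M F m.+1})
           (d : forall i, {linear augment M F i.+1 -> augment M F i}),
    [/\ forall i, (i < m.+1)%N -> flat_module (F i),
        exact_down (X := fun i => augment M F i) iota (fun i => d i) &
        forall I : lmodType R^c, injective_module I ->
          exact_down (X := fun i => tens I (augment M F i))
            (tens_map (@idfun I : {linear I -> I}) iota)
            (fun i => tens_map (@idfun I : {linear I -> I}) (d i))]
  else False.

(* In the sequence 0 -> M -> I^(n-1) -> ... -> I^0 -> M -> 0, the module
   I^(n-1-i) is J i. *)
Definition SG_injective (R : pzRingType) (n : nat) (M : lmodType R) : Prop :=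
  if n is m.+1 then
    exists (J : nat -> lmodType R)
           (d : forall i, {linear augment M J i -> augment M J i.+1})
           (p : {linear augment M J m.+1 -> M}),
    [/\ forall i, (i < m.+1)%N -> injective_module (J i),
        exact_up (X := fun i => augment M J i) (fun i => d i) p &
        forall E : lmodType R, injective_module E ->
          exact_up (X := fun i => Hom E (augment M J i))
            (fun i => Hom_map (E := E) (d i)) (Hom_map (E := E) p)]
  else False.

Definition ideal (k : comPzRingType) (I : set k) : Prop :=
  [/\ I 0, forall x y, I x -> I y -> I (x + y) & forall a x, I x -> I (a * x)].

Definition artinian (k : comPzRingType) : Prop :=
  forall I : nat -> set k, (forall i, ideal (I i)) ->
    (forall i, (I i.+1 `<=` I i)%classic) ->
    exists N, forall i, (N <= i)%N -> I i = I N.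

(* A k-algebra structure on R is a ring morphism from k to the centre of R. *)
Definition artin_algebra (R : pzRingType) : Prop :=
  exists (k : comPzRingType) (phi : {rmorphism k -> R}),
  [/\ artinian k,
      forall a x, phi a * x = x * phi a &
      exists s : seq R, forall x, exists c : nat -> k,
        x = \sum_(i < size s) phi (c i) * s`_i].

(* Main.v *)
Require Import Defs.
From HB Require Import structures.
From mathcomp Require Import all_boot all_order all_algebra.
From mathcomp Require Import boolp classical_sets functions.
From mathcomp Require Import freeg.
Import Defs.

Set Implicit Arguments.
Unset Strict Implicit.
Unset Printing Implicit Defensive.

Import Order.TTheory GRing.Theory Num.Theory.
Local Open Scope ring_scope.

(** Write X^+ for the character module of X.  Since Q/Z is an injective abelian
    group ([char_factor]), taking characters turns exact sequences into exact
    sequences in the opposite direction.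

    From flat to injective.  Hom(E, X^+) is the character group of the tensor
    product of E and X ([tens_perfect]).  Hence F^+ is injective for F flat,
    and if the defining sequence of M stays exact under tensor product with
    the injective module E, then its dual stays exact under Hom(E, -).

    From injective to flat.  For E finitely presented, the tensor product of E
    and X^+ is the character group of Hom(E, X) ([hom_perfect]): both sides can
    be computed from a finite presentation of E.  An artin algebra is
    noetherian, so this applies to every finitely generated E.  If I is
    injective, then Hom(-, I) is exact, so tensoring with I^+ is exact on
    finitely generated modules; it is then exact on all modules, because an
    equality between tensors involves finitely many elements only
    ([tsum0_fin]).  Thus I^+ is flat ([injective_char_flat]).

    It remains to see that the dual of the defining sequence stays exact under
    tensor product with any injective E.  If E is finitely generated, this is
    the duality with Hom(E, -) again.  In general a cycle with coefficients in E
    is a cycle with coefficients in a finitely generated submodule N of E.  Over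
    an artin algebra, N embeds in a finitely generated injective module G
    ([artin_algebra_embed]), and by injectivity of E the inclusion of N extends
    to a map from G to E.  The cycle becomes a boundary over G, hence over E
    ([tens_kernel_lift]).

    For the embedding of N, let k be the commutative artinian base ring.  A
    finitely generated k-module has a finitely generated injective hull, since
    over k an essential extension of a noetherian module is noetherian
    ([essential_noeth]).  If J is the hull of N over k, then N embeds over R in
    Hom_k(R, J), which is injective over R and finitely generated over k. *)


(** * Submodules, finite generation and Zorn's lemma *)

Section Submodules.
Variables (R : pzRingType).
Implicit Types (X Y : lmodType R).

Definition submod X (P : set X) : Prop :=
  [/\ P 0, forall x y, P x -> P y -> P (x + y) & forall a x, P x -> P (a *: x)].

Lemma submodN X (P : set X) x : submod P -> P x -> P (- x).
Proof. by case=> _ _ PZ Px; rewrite -scaleN1r; apply: PZ. Qed.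

Lemma submodB X (P : set X) x y : submod P -> P x -> P y -> P (x - y).
Proof. by move=> sP Px Py; case: (sP) => _ PD _; apply: PD (submodN sP Py). Qed.

Lemma submod_sum X (P : set X) (I : Type) (r : seq I) (F : I -> X) :
  submod P -> (forall i, P (F i)) -> P (\sum_(i <- r) F i).
Proof. by case=> P0 PD _ PF; apply: big_ind. Qed.

Lemma submodT X : submod [set: X].
Proof. by []. Qed.

Lemma submodI X (P Q : set X) : submod P -> submod Q -> submod (P `&` Q)%classic.
Proof.
move=> [P0 PD PZ] [Q0 QD QZ]; split=> //= [x y [Px Qx] [Py Qy]|a x [Px Qx]].
  by split; [apply: PD|apply: QD].
by split; [apply: PZ|apply: QZ].
Qed.

Lemma submod_preim X Y (f : {linear X -> Y}) (P : set Y) :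
  submod P -> submod (f @^-1` P)%classic.
Proof.
case=> P0 PD PZ; split=> [|x y Px Py|a x Px] /=; first by rewrite /= linear0.
  by rewrite linearD; apply: PD.
by rewrite linearZ; apply: PZ.
Qed.

Lemma submod_image X Y (f : {linear X -> Y}) (P : set X) :
  submod P -> submod (f @` P)%classic.
Proof.
case=> P0 PD PZ; split=> [|_ _ [x Px <-] [y Py <-]|a _ [x Px <-]].
- by exists 0; rewrite // linear0.
- by exists (x + y); rewrite ?linearD //; apply: PD.
- by exists (a *: x); rewrite ?linearZ //; apply: PZ.
Qed.

Lemma submod_ker X Y (f : {linear X -> Y}) : submod [set x | f x = 0]%classic.
Proof.
split=> /= [|x y fx fy|a x fx]; first exact: linear0.
  by rewrite linearD fx fy addr0.
by rewrite linearZ_LR /= fx scaler0.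
Qed.

Lemma submod_set0 X : submod [set 0 : X]%classic.
Proof.
by split=> //= [x y -> ->|a x ->]; rewrite ?addr0 ?scaler0.
Qed.

Fixpoint span X (s : seq X) : set X :=
  if s is x :: s' then [set z | exists a y, span s' y /\ z = a *: x + y]%classic
  else [set 0]%classic.

Lemma submod_span X (s : seq X) : submod (span s).
Proof.
elim: s => [|x s [IH0 IHD IHZ]] /=; first exact: submod_set0.
split=> [|_ _ [a [y [sy ->]]] [b [z [sz ->]]]|c _ [a [y [sy ->]]]].
- by exists 0, 0; rewrite scale0r addr0.
- exists (a + b), (y + z); split; first exact: IHD.
  by rewrite scalerDl addrACA.
- exists (c * a), (c *: y); split; first exact: IHZ.
  by rewrite scalerDr scalerA.
Qed.

Lemma mem_span X (s : seq X) x : x \in s -> span s x.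
Proof.
elim: s => //= y s IH; rewrite inE => /predU1P[->|/IH sx].
  exists 1, 0; rewrite scale1r addr0; split=> //.
  by case: (submod_span s).
by exists 0, x; rewrite scale0r add0r.
Qed.

Lemma span_sub X (s : seq X) (P : set X) :
  submod P -> (forall x, x \in s -> P x) -> (span s `<=` P)%classic.
Proof.
case=> P0 PD PZ; elim: s => [_ _ ->|x s IH sP _ [a [y [sy ->]]]] //.
apply: PD; first by apply: PZ; apply: sP; rewrite mem_head.
by apply: IH sy => z zs; apply: sP; rewrite inE zs orbT.
Qed.

Lemma span_mono X (s t : seq X) :
  {subset s <= t} -> (span s `<=` span t)%classic.
Proof. by move=> st; apply: span_sub (submod_span t) _ => x /st/mem_span. Qed.

Definition fg X (T : set X) : Prop := exists s : seq X, T = span s.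

(** This is a property of a subset of a fixed module, so that kernels, images
    and sums can be handled without quotient modules. *)
Definition noetherian X (S : set X) : Prop :=
  forall T : set X, submod T -> (T `<=` S)%classic -> fg T.

Lemma noeth_fg X (S : set X) : submod S -> noetherian S -> fg S.
Proof. by move=> sS; apply. Qed.

Lemma noeth_sub X (S T : set X) : (T `<=` S)%classic -> noetherian S -> noetherian T.
Proof. by move=> TS nS U sU UT; apply: nS sU _; apply: subset_trans TS. Qed.

Lemma span_lift X Y (f : X -> Y) (P : set X) (s : seq Y) :
  (span s `<=` f @` P)%classic ->
  exists t : seq X, (forall x, x \in t -> P x) /\ map f t = s.
Proof.
elim: s => [|y s IH] sP; first by exists [::].
have [t [tP ts]] : exists t : seq X, (forall x, x \in t -> P x) /\ map f t = s.
  apply: IH => z /(@span_mono _ s (y :: s)) zs; apply/sP/zs => u us.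
  by rewrite inE us orbT.
have [x Px fx] : (f @` P)%classic y by apply/sP/mem_span; rewrite mem_head.
exists (x :: t); split=> [z|/=]; last by rewrite fx ts.
by rewrite inE => /predU1P[->|/tP].
Qed.

Lemma span_map X Y (f : {linear X -> Y}) (s : seq X) :
  span (map f s) = (f @` span s)%classic.
Proof.
apply/seteqP; split.
  apply: span_sub; first exact/submod_image/submod_span.
  by move=> _ /mapP[x xs ->]; exists x => //; apply: mem_span.
move=> _ [x sx <-]; move: x sx.
apply: (@span_sub _ s (f @^-1` span (map f s))%classic).
  exact/submod_preim/submod_span.
by move=> x xs; apply/mem_span/map_f.
Qed.

Lemma span_cat X (s t : seq X) x :
  span (s ++ t) x <-> exists y z, [/\ span s y, span t z & x = y + z].
Proof.
split.
  move: x; apply: (@span_sub _ _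
    [set x | exists y z, [/\ span s y, span t z & x = y + z]]%classic).
    split.
  - by exists 0, 0; rewrite addr0; split=> //; case: (submod_span s);
       case: (submod_span t).
  - move=> _ _ [y [z [sy tz ->]]] [y' [z' [sy' tz' ->]]].
    exists (y + y'), (z + z'); rewrite addrACA.
    by case: (submod_span s) (submod_span t) => _ sD _ [_ tD _]; split; auto.
  - move=> a _ [y [z [sy tz ->]]]; exists (a *: y), (a *: z).
    rewrite scalerDr.
    by case: (submod_span s) (submod_span t) => _ _ sZ [_ _ tZ]; split; auto.
  move=> y; rewrite mem_cat => /orP[/mem_span sy|/mem_span ty].
    by exists y, 0; rewrite addr0; split=> //; case: (submod_span t).
  by exists 0, y; rewrite add0r; split=> //; case: (submod_span s).
case=> y [z [sy tz ->]]; case: (submod_span (s ++ t)) => _ stD _.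
by apply: stD; [move: sy | move: tz]; apply: span_mono => u us;
   rewrite mem_cat us ?orbT.
Qed.

(** Generators of f(T) lifted to T, together with generators of the part of T
    killed by f, generate T. *)
Lemma noeth_ext X Y (f : {linear X -> Y}) (S : set X) : submod S ->
  noetherian (S `&` [set x | f x = 0])%classic -> noetherian (f @` S)%classic ->
  noetherian S.
Proof.
move=> sS nK nI T sT TS.
have [t eT] := nI _ (submod_image f sT) (image_subset TS).
have [u eK] : fg (T `&` [set x | f x = 0])%classic.
  by apply: nK (submodI sT (submod_ker f)) _; apply: setSI.
have [t' [t'T et]] : exists t', (forall x, x \in t' -> T x) /\ map f t' = t.
  by apply: span_lift; rewrite eT.
exists (u ++ t'); apply/seteqP; split.
  move=> x Tx; apply/span_cat.
  have [y ty fy] : (f @` span t')%classic (f x).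
    by rewrite -span_map et -eT; exists x.
  have Ty : T y by apply: span_sub ty.
  exists (x - y), y; rewrite subrK; split=> //.
  by rewrite -eK; split; [apply: submodB|rewrite /= linearB fy subrr].
apply: span_sub => // x; rewrite mem_cat => /orP[|/t'T //].
by move=> /mem_span; rewrite -eK => -[].
Qed.

Lemma noeth_image X Y (f : {linear X -> Y}) (S : set X) : submod S ->
  noetherian S -> noetherian (f @` S)%classic.
Proof.
move=> sS nS T sT TS.
have [t eT] : fg (S `&` f @^-1` T)%classic.
  by apply: nS; [apply: submodI sS (submod_preim f sT)|move=> x []].
exists (map f t); rewrite span_map -eT; apply/seteqP; split=> [y Ty|y [x [] //]].
  by have [x Sx fx] := TS _ Ty; exists x; rewrite //= /preimage /= fx.
by move=> _ Tfx <-.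
Qed.

Lemma noeth_set0 X : noetherian [set 0 : X]%classic.
Proof.
move=> T [T0 _ _] TS; exists [::] => /=; apply/seteqP; split=> // x ->; exact: T0.
Qed.

End Submodules.

Section MaxDisjoint.
Variables (R : pzRingType) (X : lmodType R).

(** Zorn's lemma.  Maximality is used in the form of the last clause: if x is
    not in C, then C + Rx is too large, so it meets S outside 0.  The set S
    will be the vertical axis when C is the graph of a character, a line when C
    is a hyperplane, and the submodule or its complement when an injective hull
    is cut out of an injective module. *)
Lemma max_disjoint (P0 S : set X) : submod P0 ->
    (forall x, P0 x -> S x -> x = 0) ->
  exists C : set X, [/\ submod C, (P0 `<=` C)%classic,
    forall x, C x -> S x -> x = 0 &
    forall x, ~ C x -> exists c a, [/\ C c, S (c + a *: x) & c + a *: x <> 0]].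
Proof.
move=> sP0 P0S.
pose good (A : set X) :=
  [/\ submod A, (P0 `<=` A)%classic & forall x, A x -> S x -> x = 0].
have [|C [C_or maxC]] := @Zorn_bigcup X (fun A => A = set0 \/ good A).
  move=> F Fgood Ftot.
  have [[A FA gA]|Fno] := pselect (exists2 A, F A & good A); last first.
    left; apply/seteqP; split=> // x [A FA Ax].
    by case: (Fgood A FA) => [A0|gA]; [rewrite -A0|case: Fno; exists A].
  right.
  have gF B x : F B -> B x -> good B.
    by move=> /Fgood[-> //|].
  split; first split.
  - by exists A => //; case: gA => -[].
  - move=> x y [B FB Bx] [B' FB' B'y].
    case: (Ftot _ _ FB FB') => BB'.
      exists B' => //; have [[_ BD _] _ _] := gF _ _ FB' B'y.
      by apply: BD => //; apply: BB'.
    exists B => //; have [[_ BD _] _ _] := gF _ _ FB Bx.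
    by apply: BD => //; apply: BB'.
  - move=> a x [B FB Bx]; exists B => //; have [[_ _ BZ] _ _] := gF _ _ FB Bx.
    exact: BZ.
  - by move=> x P0x; exists A => //; case: gA => _ P0A _; apply: P0A.
  - move=> x [B FB Bx]; have [_ _ BS] := gF _ _ FB Bx; exact: BS.
have gP0 : good P0 by split.
have {C_or} [sC P0C CS] : good C.
  case: C_or => // C0; case: (maxC P0); last by right.
  split; first by rewrite C0.
  by rewrite C0 => /(_ 0); case: sP0 => P00 _ _ /(_ P00).
exists C; split=> // x nCx.
have [C0 CD CZ] := sC.
apply: contrapT => nS.
case: (maxC [set z | exists c a, C c /\ z = c + a *: x]%classic).
  split; first by move=> c Cc; exists c, 0; rewrite scale0r addr0.
  by apply/existsPNP; exists x => //; exists 0, 1; rewrite scale1r add0r.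
right; split; first split.
- by exists 0, 0; rewrite scale0r addr0.
- move=> _ _ [c [a [Cc ->]]] [d [b [Cd ->]]]; exists (c + d), (a + b).
  by split; [apply: CD|rewrite scalerDl addrACA].
- move=> b _ [c [a [Cc ->]]]; exists (b *: c), (b * a).
  by split; [apply: CZ|rewrite scalerDr scalerA].
- by move=> z /P0C Cz; exists z, 0; rewrite scale0r addr0.
- move=> _ [c [a [Cc ->]]] Sz; apply: contrapT => z0.
  by apply: nS; exists c, a.
Qed.

End MaxDisjoint.

(** * Submodules as modules, and characters of abelian groups *)

Definition additive_of (A B : zmodType) (f : A -> B) (fB : zmod_morphism f) :
  {additive A -> B} := HB.pack f (GRing.isZmodMorphism.Build A B f fB).

Lemma morphD_zmod (A B : zmodType) (f : A -> B) :
  {morph f : x y / x + y} -> zmod_morphism f.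
Proof.
by move=> fD x y; apply: (addIr (f y)); rewrite -fD !subrK.
Qed.

Definition linear_of (R : pzRingType) (X Y : lmodType R) (f : X -> Y)
    (fD : {morph f : x y / x + y}) (fZ : forall a x, f (a *: x) = a *: f x) :
  {linear X -> Y} :=
  HB.pack f (GRing.isZmodMorphism.Build X Y f (morphD_zmod fD))
            (GRing.isScalable.Build R X Y *:%R f fZ).

Section SubmoduleType.
Variables (R : pzRingType) (X : lmodType R) (P : set X) (sP : submod P).

(** The proof sP is an argument so that the algebraic instances below can be
    found from the type of the submodule. *)
Definition in_submod (_ : submod P) : pred X := fun x => `[< P x >].

Fact in_submod_closed : submod_closed (in_submod sP).
Proof.
case: (sP) => P0 PD PZ; split=> [|a x y /asboolP Px /asboolP Py].
  exact/asboolP.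
by apply/asboolP/PD => //; apply: PZ.
Qed.


Definition submodule : Type := {x : X | in_submod sP x}.
HB.instance Definition _ := SubChoice.on submodule.
HB.instance Definition _ := GRing.SubChoice_isSubLmodule.Build R X
  (in_submod sP) submodule in_submod_closed.

Definition incl : {linear submodule -> X} := (val : submodule -> X).

Lemma inclP (u : submodule) : P (incl u).
Proof. exact/asboolP/(valP u). Qed.

Lemma incl_inj : injective incl.
Proof. exact: val_inj. Qed.

(** A retraction of sets, with junk value 0 outside P; it is linear on P, which
    is all that is needed to push finitely many elements of P into the
    submodule. *)
Definition retr (x : X) : submodule := insubd 0 x.

Lemma retrK x : P x -> incl (retr x) = x.
Proof. by move=> Px; rewrite /incl /= insubdK //; apply/asboolP. Qed.

Lemma retrD x y : P x -> P y -> retr (x + y) = retr x + retr y.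
Proof.
move=> Px Py; apply: incl_inj; rewrite linearD !retrK //.
by case: sP => _ PD _; apply: PD.
Qed.

Lemma retrZ a x : P x -> retr (a *: x) = a *: retr x.
Proof.
move=> Px; apply: incl_inj; rewrite linearZ !retrK //.
by case: sP => _ _; apply.
Qed.

Lemma corestr (Y : lmodType R) (f : {linear Y -> X}) : (forall y, P (f y)) ->
  exists g : {linear Y -> submodule}, forall y, incl (g y) = f y.
Proof.
move=> Pf; have hD : {morph retr \o f : x y / x + y}.
  by move=> x y /=; rewrite linearD retrD.
have hZ a y : (retr \o f) (a *: y) = a *: (retr \o f) y.
  by rewrite /= linearZ_LR /= retrZ.
by exists (linear_of hD hZ) => y; apply: retrK.
Qed.

End SubmoduleType.

(** The hypothesis makes h a map on the image of g, which is a submodule of C. *)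
Lemma inj_factor (R : pzRingType) (E B C : lmodType R) (g : {linear B -> C})
    (h : {linear B -> E}) : injective_module E ->
  (forall b, g b = 0 -> h b = 0) ->
  exists h' : {linear C -> E}, forall b, h' (g b) = h b.
Proof.
move=> injE gh.
have sI := submod_image g (submodT B).
have pre (u : submodule sI) : exists b, g b = incl sI u.
  by have [b _] := inclP u; exists b.
have [p pP] := choice pre.
have hg b b' : g b = g b' -> h b = h b'.
  by move=> e; apply/eqP; rewrite -subr_eq0 -linearB gh // linearB e subrr.
have fD : {morph h \o p : x y / x + y}.
  by move=> x y /=; rewrite -linearD; apply: hg; rewrite linearD !pP linearD.
have fZ a x : (h \o p) (a *: x) = a *: (h \o p) x.
  by rewrite /= -linearZ; apply: hg; rewrite linearZ_LR /= !pP linearZ.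
have [h' h'P] := injE _ _ (incl sI) (linear_of fD fZ) (@incl_inj _ _ _ sI).
exists h' => b; have gb : (g @` setT)%classic (g b) by exists b.
by rewrite -(retrK sI gb) h'P /=; apply: hg; rewrite pP retrK.
Qed.


(** The subgroup of integers through which Q/Z is defined. *)
Definition Zrat : zmodClosed rat := 
  GRing.ZmodClosed.clone rat Num.int_num_subdef _.

Definition qz (q : rat) : QmodZ := (\pi_(Quotient.quot Zrat) q)%qT.

Fact qz_additive : zmod_morphism qz.
Proof. by move=> x y; rewrite /qz !piE. Qed.

HB.instance Definition _ := GRing.isZmodMorphism.Build _ _ qz qz_additive.

Lemma qz_eq0 q : (qz q == 0) = (q \is a Num.int).
Proof. by rewrite /qz piE Quotient.equivE subr0. Qed.

Lemma qz_surj y : exists q, y = qz q.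
Proof. by exists (repr (y : Quotient.quot Zrat)); rewrite /qz reprK. Qed.

Lemma QmodZ_div (y : QmodZ) (n : nat) : (0 < n)%N -> exists x, x *+ n = y.
Proof.
move=> n0; have [q ->] := qz_surj y; exists (qz (q / n%:R)).
by rewrite -raddfMn /= -(mulr_natr (q / n%:R)) divfK // pnatr_eq0 -lt0n.
Qed.

(** Q/Z is an injective abelian group.  The pairs (i a, f a) form a subgroup of
    B * Q/Z meeting 0 * Q/Z trivially; a maximal such subgroup is the graph of
    a total map because Q/Z is divisible. *)
Lemma char_factor (A B : zmodType) (i : {additive A -> B})
    (f : {additive A -> QmodZ}) : (forall a, i a = 0 -> f a = 0) ->
  exists g : {additive B -> QmodZ}, forall a, g (i a) = f a.
Proof.
move=> fi; pose X : lmodType int := (zmodule B * zmodule QmodZ)%type.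
have XZ (n : int) (b : B) (y : QmodZ) : n *: ((b, y) : X) = (b *~ n, y *~ n).
  by rewrite -!scalezrE.
pose P0 : set X := [set z | exists a, z = (i a, f a)]%classic.
pose S : set X := [set z | z.1 = 0]%classic.
have sP0 : submod P0.
  split=> [|_ _ [a ->] [b ->]|n _ [a ->]]; first by exists 0; rewrite !raddf0.
    by exists (a + b); rewrite !raddfD.
  by exists (a *~ n); rewrite XZ !raddfMz.
have [|G [sG P0G GS maxG]] := @max_disjoint _ X P0 S sP0.
  by move=> _ [a ->] ia; have {}ia : i a = 0 := ia; rewrite ia fi.
have [G0 GD GZ] := sG.
have Gfun b y y' : G (b, y) -> G (b, y') -> y = y'.
  move=> Gy Gy'; have := GS _ (submodB sG Gy Gy').
  by move=> /(_ (subrr b)) [_ /eqP]; rewrite subr_eq0 => /eqP.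
have Gtot b : exists y, G (b, y).
  apply: contrapT => nGb.
  (* If some nonzero multiple of b is in the domain of G, take b *~ m with m > 0
     least, and let v be its value; dividing v by m gives a value y at b
     compatible with G, so that adjoining (b, y) to G keeps it a graph. *)
  pose M (n : nat) := `[< (0 < n)%N /\ exists y, G (b *+ n, y) >].
  have [y yP] : exists y, forall n : int, forall w, G (b *~ n, w) -> w = y *~ n.
    have GN n w : G (b *~ n, w) -> G (b *~ (- n), - w).
      by move=> /(submodN sG) h; rewrite mulrNz.
    have [[n0 Mn0]|noM] := pselect (exists n, M n); last first.
      exists 0 => n w Gw; rewrite mul0rz.
      suff n0 : n = 0 by apply: (Gfun 0); rewrite // -(mulr0z b) -n0.
      apply: contrapT => /eqP n0; apply: noM; exists `|n|%N; apply/asboolP.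
      rewrite absz_gt0; split=> //.
      case: (intP n) Gw n0 => // k Gw _; first by exists w.
      by exists (- w); have := GN _ _ Gw; rewrite opprK.
    pose exM : exists n, M n := ex_intro _ n0 Mn0.
    case: (ex_minnP exM) => m /asboolP[m0 [v Gv]] minm.
    have [y yv] := QmodZ_div v m0; exists y => n w Gw.
    have eqn := divz_eq n m.
    have Gq : G (b *~ ((n %/ m)%Z * m), y *~ ((n %/ m)%Z * m)).
      rewrite ![((n %/ m)%Z * m)%R]mulrC !mulrzA -!pmulrn yv.
      by rewrite -XZ; apply: GZ.
    have Gr : G (b *~ (n %% m)%Z, w - y *~ ((n %/ m)%Z * m)).
      have := submodB sG Gw Gq; rewrite {1}eqn mulrzDr.
      by congr (G _); congr (_, _); rewrite /= [X in X - _]addrC addrK.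
    suff r0 : (n %% m)%Z = 0.
      rewrite r0 mulr0z in Gr; have := Gfun _ _ _ Gr G0.
      by move/eqP; rewrite subr_eq0 => /eqP->; rewrite [in RHS]eqn r0 addr0.
    have m_n0 : m%:Z != 0 by rewrite eqz_nat -lt0n.
    case r_eq : (n %% m)%Z (modz_ge0 n m_n0) (ltz_pmod n (m0 : 0 < m%:Z)) Gr
      => [r|//] _ rm Gr.
    congr Posz; apply/eqP; rewrite -leqn0 leqNgt; apply/negP=> r0.
    have : M r by apply/asboolP; split=> //; eexists; exact: Gr.
    by move/minm; rewrite leqNgt; apply/negP; rewrite negbK.
  have [|[c w] [n []]] := maxG (b, y); first by move=> Gby; apply: nGb; exists y.
  rewrite XZ => Gc /= cb; apply.
  have {}cb : c + b *~ n = 0 by [].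
  have Gw : G (b *~ (- n), w).
    suff <- : c = b *~ (- n) by [].
    by rewrite mulrNz; apply/eqP; rewrite -addr_eq0 cb.
  by congr (_, _) => //=; rewrite (yP _ _ Gw) mulrNz addNr.
have [g gP] := choice Gtot.
have gD : {morph g : x y / x + y}.
  by move=> x y; apply: Gfun (gP _) _; apply: (GD (x, g x) (y, g y)).
exists (additive_of (morphD_zmod gD)) => a; apply: Gfun (gP _) _.
by apply: P0G; exists a.
Qed.

(** * Duality between exact sequences *)

Lemma invn_not_int (m : nat) : (1 < m)%N -> (m%:R^-1 : rat) \isn't a Num.int.
Proof.
move=> m1; have m0 : 0 < m%:R :> rat by rewrite ltr0n ltnW.
apply/negP => /norm_intr_ge1; rewrite invr_eq0 gt_eqF // => /(_ isT).
by rewrite normfV gtr0_norm // leNgt invf_lt1 // ltr1n m1.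
Qed.

(** The cyclic group generated by b has a character that is nonzero at b, and
    it extends to B. *)
Lemma char_separates (B : zmodType) (b : B) :
  b <> 0 -> exists g : {additive B -> QmodZ}, g b <> 0.
Proof.
move=> b0.
have iD : zmod_morphism (fun n : int => b *~ n) by move=> m n; rewrite mulrzBr.
(* q = 1/m with m the order of b, or m = 2 if the order is infinite *)
have [q [q1 qP]] : exists q : rat, q \isn't a Num.int /\
    forall n : int, b *~ n = 0 -> q *~ n \is a Num.int.
  pose M (n : nat) := (0 < n)%N && (b *+ n == 0).
  have [[n0 Mn0]|noM] := pselect (exists n, M n); last first.
    exists (2%:R^-1); split=> [|n bn]; first exact: invn_not_int.
    suff -> : n = 0 by rewrite mulr0z.
    apply: contrapT => /eqP n0; apply: noM; exists `|n|%N.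
    rewrite /M absz_gt0 n0; case: (intP n) n0 bn => [//|k|k] _ bk /=.
      by rewrite pmulrn bk.
    by rewrite pmulrn -oppr_eq0 -mulrNz bk.
  have exM : exists n, M n by exists n0.
  case: (ex_minnP exM) => m /andP[m0 /eqP bm] minm.
  have m1 : (1 < m)%N by case: m m0 bm {minm} => [|[|m]].
  exists (m%:R^-1); split=> [|n bn]; first exact: invn_not_int.
  have m_n0 : m%:Z != 0 by rewrite eqz_nat -lt0n.
  suff r0 : (n %% m)%Z = 0.
    rewrite {1}(divz_eq n m) r0 addr0 mulrC mulrzA -pmulrn.
    have -> : m%:R^-1 *+ m = 1 :> rat.
      by rewrite -(mulr_natr (m%:R^-1)) mulVf // pnatr_eq0 -lt0n.
    by rewrite intr_int.
  have br : b *~ (n %% m)%Z = 0.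
    move: bn; rewrite {1}(divz_eq n m) mulrzDr mulrC mulrzA -pmulrn bm.
    by rewrite mul0rz add0r.
  case: (n %% m)%Z (modz_ge0 n m_n0) (ltz_pmod n (m0 : 0 < m%:Z)) br => [r|//].
  move=> _ rm br; congr Posz; apply/eqP; rewrite -leqn0 leqNgt; apply/negP=> r0.
  have : M r by rewrite /M r0 pmulrn br eqxx.
  by move/minm; rewrite leqNgt; apply/negP; rewrite negbK.
have fD : zmod_morphism (fun n : int => qz q *~ n).
  by move=> m n; rewrite mulrzBr.
have [n bn|g gP] := @char_factor _ _ (additive_of iD) (additive_of fD).
  by apply/eqP; rewrite /= -raddfMz qz_eq0; apply: qP.
exists g; rewrite -[b in g b]mulr1z -[b *~ 1]/(additive_of iD 1) gP /= mulr1z.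
by apply/eqP; rewrite qz_eq0.
Qed.

Section PerfectPairing.

(** The pairing th identifies A' with the character group of A.  Exactness
    passes from maps to their adjoints under such pairings, whether A' is a
    group of characters, of homomorphisms or of tensors. *)
Record perfect (A A' : zmodType) (th : A' -> A -> QmodZ) : Prop := Perfect {
  perfect_addl : forall a, zmod_morphism (th^~ a);
  perfect_addr : forall a', zmod_morphism (th a');
  perfect_inj : forall a', (forall a, th a' a = 0) -> a' = 0;
  perfect_surj : forall g : {additive A -> QmodZ},
    exists a', forall a, th a' a = g a }.

Lemma perfect0l (A A' : zmodType) (th : A' -> A -> QmodZ) a :
  perfect th -> th 0 a = 0.
Proof. by move=> /perfect_addl/(_ a) D; have := D 0 0; rewrite !subrr. Qed.

Lemma perfect0r (A A' : zmodType) (th : A' -> A -> QmodZ) a :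
  perfect th -> th a 0 = 0.
Proof. by move=> /perfect_addr/(_ a) D; have := D 0 0; rewrite !subrr. Qed.

Lemma perfect_eq (A A' : zmodType) (th : A' -> A -> QmodZ) x y :
  perfect th -> (forall a, th x a = th y a) -> x = y.
Proof.
move=> pA xy; apply/eqP; rewrite -subr_eq0; apply/eqP/(perfect_inj pA) => a.
by rewrite (perfect_addl pA) xy subrr.
Qed.

Definition adjoint (A A' B B' : zmodType) (tA : A' -> A -> QmodZ)
  (tB : B' -> B -> QmodZ) (f : A -> B) (f' : B' -> A') : Prop :=
  forall b a, tA (f' b) a = tB b (f a).

Variables (A B C A' B' C' : zmodType).
Variables (tA : A' -> A -> QmodZ) (tB : B' -> B -> QmodZ) (tC : C' -> C -> QmodZ).
Hypotheses (pA : perfect tA) (pB : perfect tB) (pC : perfect tC).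
Variables (f : {additive A -> B}) (g : {additive B -> C}).
Variables (f' : B' -> A') (g' : C' -> B').
Hypotheses (ff' : adjoint tA tB f f') (gg' : adjoint tB tC g g').

(** A character of B killed by f' vanishes on the kernel of g, so it factors
    through g. *)
Lemma exact_dual : exact_at f g -> exact_at g' f'.
Proof.
move=> ex y; split=> [fy|[x <-]]; last first.
  apply: (perfect_inj pA) => a; rewrite ff' gg'.
  suff -> : g (f a) = 0 by apply: perfect0r.
  by apply/ex; exists a.
have [z|h hP] := @char_factor _ _ g (additive_of (perfect_addr pB y)).
  by move=> /ex[a <-]; rewrite /= -ff' fy; apply: perfect0l.
have [x xP] := perfect_surj pC h; exists x; apply: (perfect_eq pB) => b.
by rewrite gg' xP hP.
Qed.

Lemma inj_dual : injective f -> forall x, exists y, f' y = x.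
Proof.
move=> fI x; have [a|h hP] := @char_factor _ _ f (additive_of (perfect_addr pA x)).
  move=> fa; suff -> : a = 0 by apply: perfect0r.
  by apply: fI; rewrite fa raddf0.
have [y yP] := perfect_surj pB h; exists y; apply: (perfect_eq pA) => a.
by rewrite ff' yP hP.
Qed.

Lemma surj_dual : (forall y, exists x, f x = y) -> injective f'.
Proof.
move=> fS x y exy; apply: (perfect_eq pB) => b; have [a <-] := fS b.
by rewrite -!ff' exy.
Qed.

End PerfectPairing.

Lemma exact_down_dual (m : nat) (L L' : zmodType) (X X' : nat -> zmodType)
    (tL : L' -> L -> QmodZ) (tX : forall i, X' i -> X i -> QmodZ)
    (iota : {additive L -> X m.+1}) (d : forall i, {additive X i.+1 -> X i})
    (p : X' m.+1 -> L') (d' : forall i, X' i -> X' i.+1) :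
  perfect tL -> (forall i, perfect (tX i)) ->
  adjoint tL (tX _) iota p -> (forall i, adjoint (tX _) (tX _) (d i) (d' i)) ->
  exact_down iota (fun i => d i) -> exact_up d' p.
Proof.
move=> pL pX aL aX [iI eL eX dS]; split.
- exact: (surj_dual (pX 0%N) (aX 0%N) dS).
- move=> i im.
  exact: (exact_dual (pX _) (pX _) (pX _) (aX i.+1) (aX i) (eX i im)).
- exact: (exact_dual pL (pX _) (pX _) aL (aX m) eL).
- exact: (inj_dual pL (pX _) aL iI).
Qed.

Lemma exact_up_dual (m : nat) (L L' : zmodType) (X X' : nat -> zmodType)
    (tL : L' -> L -> QmodZ) (tX : forall i, X' i -> X i -> QmodZ)
    (p : {additive X m.+1 -> L}) (d : forall i, {additive X i -> X i.+1})
    (iota : L' -> X' m.+1) (d' : forall i, X' i.+1 -> X' i) :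
  perfect tL -> (forall i, perfect (tX i)) ->
  adjoint (tX _) tL p iota -> (forall i, adjoint (tX _) (tX _) (d i) (d' i)) ->
  exact_up (fun i => d i) p -> exact_down iota d'.
Proof.
move=> pL pX aL aX [dI eX eL pS]; split.
- exact: (surj_dual pL aL pS).
- exact: (exact_dual (pX _) (pX _) pL (aX m) aL eL).
- move=> i im.
  exact: (exact_dual (pX _) (pX _) (pX _) (aX i) (aX i.+1) (eX i im)).
- exact: (inj_dual (pX _) (pX _) (aX 0%N) dI).
Qed.

(** * Characters of flat modules *)

Definition char_map (R : pzRingType) (X Y : lmodType R) (f : {linear X -> Y})
    (h : char Y) : char X := h \o f.

Section CharMap.
Variables (R : pzRingType) (X Y : lmodType R) (f : {linear X -> Y}).

Fact char_map_additive : zmod_morphism (char_map f).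
Proof. by move=> g h; apply: charP. Qed.
Fact char_map_scalable : scalable (char_map f : char Y -> char X).
Proof. by move=> r h; apply: charP => x /=; rewrite linearZ. Qed.

HB.instance Definition _ := GRing.isZmodMorphism.Build (char Y) (char X)
  (char_map f) char_map_additive.
HB.instance Definition _ := GRing.isScalable.Build R^c (char Y) (char X) *:%R
  (char_map f) char_map_scalable.

Definition char_lin : {linear (char Y : lmodType R^c) -> (char X : lmodType R^c)}
  := char_map f.
End CharMap.

Definition char_ev (R : pzRingType) (X : lmodType R) (h : char X) (x : X) := h x.

Lemma char_perfect (R : pzRingType) (X : lmodType R) : perfect (@char_ev R X).
Proof.
split=> [x g h|h|h h0|g] //; first by move=> x y; apply: raddfB.
  by apply: charP => x; apply: h0.
by exists g.
Qed.

Lemma char_map_adjoint (R : pzRingType) (X Y : lmodType R) (f : {linear X -> Y}) :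
  adjoint (@char_ev R X) (@char_ev R Y) f (char_map f).
Proof. by []. Qed.

Section TensorHom.
Variables (R : pzRingType) (E : lmodType R^c) (X : lmodType R).

Definition tens_ev (h : Hom E (char X)) : tens E X -> QmodZ :=
  tens_lift (fun e x => (h e : char X) x).

Lemma tens_ev_balanced (h : Hom E (char X)) :
  balanced (fun e x => (h e : char X) x).
Proof.
by split=> [e e' x|e x y|r e x]; rewrite ?linearD ?raddfD //= linearZ_LR.
Qed.

Lemma tens_evE h e x : tens_ev h (pure e x) = (h e : char X) x.
Proof. exact/tens_lift_pure/tens_ev_balanced. Qed.

HB.instance Definition _ h := GRing.isZmodMorphism.Build (tens E X) QmodZ
  (tens_ev h) (tens_lift_additive (tens_ev_balanced h)).

(** The adjunction between tensor product and Hom, with values in Q/Z. *)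
Lemma tens_perfect : perfect tens_ev.
Proof.
split=> [t g h|h|h h0|g].
- pose k : {additive tens E X -> QmodZ} := tens_ev g \- tens_ev h.
  suff e : tens_ev (g - h) =1 k by rewrite e.
  by apply: tens_ext => e x; rewrite /= !tens_evE.
- exact: raddfB.
- by apply: HomP => e; apply: charP => x; rewrite -tens_evE h0.
have [pl pr ps] := pure_balanced E X.
have hA e : zmod_morphism (fun x => g (pure e x)).
  by apply: morphD_zmod => x y; rewrite pr raddfD.
have hD : {morph (fun e => additive_of (hA e) : char X) : e e' / e + e'}.
  by move=> e e'; apply: charP => x /=; rewrite pl raddfD.
have hZ r e :
    (additive_of (hA (r *: e)) : char X) = r *: (additive_of (hA e) : char X).
  by apply: charP => x /=; rewrite ps.
exists (linear_of hD hZ) => t; move: t.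
by apply: tens_ext => e x; rewrite /= tens_evE.
Qed.

End TensorHom.

Lemma tens_map_adjoint (R : pzRingType) (E : lmodType R^c) (X Y : lmodType R)
    (f : {linear X -> Y}) :
  adjoint (@tens_ev R E X) (@tens_ev R E Y) (tens_map idfun f)
    (Hom_map (char_lin f)).
Proof.
move=> h; pose k : {additive tens E X -> QmodZ} :=
  tens_ev h \o tens_map (@idfun E : {linear E -> E}) f.
suff e : tens_ev (Hom_map (char_lin f) h) =1 k by move=> t; apply: e.
by apply: tens_ext => e x; rewrite /= tens_map_pure !tens_evE.
Qed.

Lemma tens_map_adjointl (R : pzRingType) (E E' : lmodType R^c) (X : lmodType R)
    (f : {linear E -> E'}) :
  adjoint (@tens_ev R E X) (@tens_ev R E' X) (tens_map f idfun)
    (fun h : Hom E' (char X) => h \o f : Hom E (char X)).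
Proof.
move=> h; pose k : {additive tens E X -> QmodZ} :=
  tens_ev h \o tens_map f (@idfun X : {linear X -> X}).
suff e : tens_ev (h \o f : Hom E (char X)) =1 k by move=> t; apply: e.
by apply: tens_ext => e x; rewrite /= tens_map_pure !tens_evE.
Qed.

(** Injectivity of i is exactness of 0 followed by i, for the zero map of A. *)
Lemma flat_tens_inj (R : pzRingType) (F : lmodType R) (A B : lmodType R^c)
    (i : {linear A -> B}) : flat_module F -> injective i ->
  injective (tens_map i (@idfun F : {linear F -> F})).
Proof.
move=> flatF iI; apply: raddf_inj => t.
have : exact_at (\0 : A -> A) i.
  move=> y; split=> [iy|[x <-]]; last exact: linear0.
  by exists y; apply: iI; rewrite iy linear0.
move=> /(flatF _ _ _ (\0 : {linear A -> A}) i)/(_ t)[h _] /h[u <-].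
pose z : {additive tens A F -> tens A F} := \0.
suff e : tens_map (\0 : {linear A -> A}) (@idfun F : {linear F -> F}) =1 z.
  exact: e.
have [pl _ _] := pure_balanced A F.
apply: tens_ext => e x; rewrite /= tens_map_pure /=.
by apply: (addrI (pure 0 x)); rewrite -pl !addr0.
Qed.

(** Lambek: Hom(-, F^+) is the character group of - tensor F. *)
Lemma flat_char_injective (R : pzRingType) (F : lmodType R) :
  flat_module F -> injective_module (char F : lmodType R^c).
Proof.
move=> flatF A B i f iI.
have [g gP] := inj_dual (tens_perfect A F) (tens_perfect B F)
  (@tens_map_adjointl _ _ _ _ i) (flat_tens_inj flatF iI) (f : Hom A (char F)).
exists g => x.
exact: (congr1 (fun h : Hom A (char F) => h x) gP).
Qed.

(** Families X with X 0 = M replace augmented families, because characters of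
    such a family form again such a family. *)
Lemma augment0 (T : Type) (X : nat -> T) :
  augment (X 0%N) (fun i => X i.+1) = X.
Proof. by apply/funext => -[]. Qed.

Lemma SG_injective_intro (R : pzRingType) (m : nat) (X : nat -> lmodType R)
    (d : forall i, {linear X i -> X i.+1}) (p : {linear X m.+1 -> X 0%N}) :
  (forall i, (i < m.+1)%N -> injective_module (X i.+1)) ->
  exact_up (X := fun i => X i) (fun i => d i) p ->
  (forall E : lmodType R, injective_module E ->
    exact_up (X := fun i => Hom E (X i))
      (fun i => Hom_map (E := E) (d i)) (Hom_map (E := E) p)) ->
  SG_injective m.+1 (X 0%N).
Proof.
move=> XI ex exE; exists (fun i => X i.+1).
by move: d p ex exE; case: _ / (esym (augment0 X)) => d p ex exE; exists d, p.
Qed.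

Lemma SG_flat_intro (R : pzRingType) (m : nat) (X : nat -> lmodType R)
    (iota : {linear X 0%N -> X m.+1}) (d : forall i, {linear X i.+1 -> X i}) :
  (forall i, (i < m.+1)%N -> flat_module (X i.+1)) ->
  exact_down (X := fun i => X i) iota (fun i => d i) ->
  (forall I : lmodType R^c, injective_module I ->
    exact_down (X := fun i => tens I (X i))
      (tens_map (@idfun I : {linear I -> I}) iota)
      (fun i => tens_map (@idfun I : {linear I -> I}) (d i))) ->
  SG_flat m.+1 (X 0%N).
Proof.
move=> XI ex exE; exists (fun i => X i.+1).
by move: iota d ex exE; case: _ / (esym (augment0 X)) => d p ex exE; exists d, p.
Qed.

Theorem SG_flat_char (R : pzRingType) (n : nat) (M : lmodType R) :
  SG_flat n M -> SG_injective n (char M : lmodType R^c).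
Proof.
case: n => // m [F [iota [d [flatF ex exI]]]].
pose X i : lmodType R^c := char (augment M F i).
apply: (@SG_injective_intro _ m X (fun i => char_lin (d i)) (char_lin iota)).
- by move=> i im; apply/flat_char_injective/flatF.
- exact: (exact_down_dual (char_perfect M) (fun i => char_perfect (augment M F i))
    (@char_map_adjoint _ _ _ iota) (fun i => @char_map_adjoint _ _ _ (d i)) ex).
move=> E injE.
exact: (exact_down_dual (tens_perfect E M)
    (fun i => tens_perfect E (augment M F i))
    (@tens_map_adjoint _ _ _ _ iota) (fun i => @tens_map_adjoint _ _ _ _ (d i))
    (exI E injE)).
Qed.

(** * Commutative artinian rings *)

Lemma dependent_choice (T : Type) (F : T -> Prop) (R : T -> T -> Prop) (x0 : T) :
  F x0 -> (forall x, F x -> exists y, F y /\ R x y) ->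
  exists u : nat -> T, forall n, F (u n) /\ R (u n) (u n.+1).
Proof.
move=> Fx0 FR.
have [|nx nxP] := @choice T T (fun x y => F x -> F y /\ R x y).
  move=> x.
  have [Fx|nFx] := pselect (F x); last by exists x.
  by have [y yP] := FR x Fx; exists y.
exists (fun n => iter n nx x0).
have Fn n : F (iter n nx x0) by elim: n => //= n /nxP[].
by move=> n; split=> //=; case: (nxP _ (Fn n)).
Qed.

Lemma noeth_max (R : pzRingType) (X : lmodType R) (F : set (set X)) (A0 : set X) :
  noetherian [set: X] -> (forall A, F A -> submod A) -> F A0 ->
  exists A, F A /\ forall B, F B -> (A `<=` B)%classic -> B = A.
Proof.
move=> nX sF FA0; apply: contrapT => nmax.
have [A FA|u uP] := @dependent_choice _ F (fun A B => (A `<` B)%classic) A0 FA0.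
  apply: contrapT => nB; apply: nmax; exists A; split=> // B FB AB.
  apply: contrapT => BA; apply: nB; exists B; split=> //; split=> // BA'.
  by apply: BA; apply/seteqP.
have uS n : (u n `<=` u n.+1)%classic by case: (uP n) => _ [].
have mono m n : (m <= n)%N -> (u m `<=` u n)%classic.
  move/subnK <-; elim: (n - m)%N => [|k IH]; first by rewrite add0n.
  by rewrite addSn; apply: subset_trans IH (uS _).
have [s es] : fg (\bigcup_n u n)%classic.
  apply: nX => //; split=> [|x y [m _ ux] [n _ uy]|a x [n _ ux]].
  - by exists 0%N => //; case: (sF _ (uP 0%N).1).
  - exists (maxn m n) => //; case: (sF _ (uP (maxn m n)).1) => _ uD _.
    by apply: uD; [apply: mono ux; apply: leq_maxl|apply: mono uy; apply: leq_maxr].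
  - by exists n => //; case: (sF _ (uP n).1) => _ _; apply.
have [N sN] : exists N, forall x, x \in s -> u N x.
  have : forall x, x \in s -> (\bigcup_n u n)%classic x.
    by move=> x /mem_span; rewrite es.
  elim: s {es} => [|x s IH] su; first by exists 0%N.
  have [N sN] := IH (fun y ys => su y (mem_behead (s := x :: s) ys)).
  have [n _ ux] := su x (mem_head x s).
  exists (maxn n N) => y; rewrite inE => /predU1P[->|/sN yN].
    by apply: mono ux; apply: leq_maxl.
  by apply: mono yN; apply: leq_maxr.
case: (uP N) => _ [_]; apply=> x uNx.
apply: (@span_sub _ _ s); [by case: (uP N) => /sF|exact: sN|].
by rewrite -es; exists N.+1.
Qed.

Section Artinian.
Variables (k : comPzRingType) (art_k : artinian k).

Lemma artin_min (F : set (set k^o)) (A0 : set k^o) :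
  (forall A, F A -> submod A) -> F A0 ->
  exists A, F A /\ forall B, F B -> (B `<=` A)%classic -> B = A.
Proof.
move=> sF FA0; apply: contrapT => nmin.
have [A FA|u uP] := @dependent_choice _ F (fun A B => (B `<` A)%classic) A0 FA0.
  apply: contrapT => nB; apply: nmin; exists A; split=> // B FB BA.
  apply: contrapT => AB; apply: nB; exists B; split=> //; split=> // AB'.
  by apply: AB; apply/seteqP.
have [||N uN] := art_k (I := u).
- by move=> n; apply: sF; case: (uP n).
- by move=> n; case: (uP n) => _ [].
by case: (uP N) => _ []; rewrite uN // => _; apply.
Qed.

(** If c^N = d c^(N+1), then c^N (1 - d c) = 0 lies in P, and primality strips
    off the factors c. *)
Lemma artin_inv (P : set k) c :
  (forall a b, P (a * b) -> P a \/ P b) -> P 0 -> ~ P c ->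
  exists d, P (1 - d * c).
Proof.
move=> primeP P0 Pc.
have [||N cN] := art_k (I := fun n => [set x | exists y, x = y * c ^+ n]%classic).
- move=> n; split=> [|_ _ [x ->] [y ->]|a _ [x ->]].
  + by exists 0; rewrite mul0r.
  + by exists (x + y); rewrite mulrDl.
  + by exists (a * x); rewrite mulrA.
- by move=> n _ [y ->]; exists (y * c); rewrite exprS mulrA.
have [d cd] : [set x | exists y, x = y * c ^+ N.+1]%classic (c ^+ N).
  by rewrite cN //; exists 1; rewrite mul1r.
exists d; have : P (c ^+ N * (1 - d * c)).
  rewrite mulrBr mulr1 {1}cd exprS.
  by rewrite [c ^+ N * (d * c)]mulrCA [c ^+ N * c]mulrC subrr.
elim: N {cN cd} => [|N IH]; first by rewrite mul1r.
by rewrite exprS -mulrA => /primeP[].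
Qed.

Definition scalek (X : lmodType k) (a : k) : {linear X -> X} := ( *:%R a).

(** Akizuki's theorem.  Let I be a minimal non-noetherian ideal.  A scalar a has
    aI = I or aI = 0, since otherwise aI and the kernel of a on I are both
    noetherian.  So ann I is prime, scalars outside it are invertible on I, and
    I is the sum of a line and a proper ideal, which is noetherian; hence I is
    finitely generated, which contradicts its choice. *)
Lemma artinian_noeth : noetherian [set: k^o].
Proof.
apply: contrapT => nk.
have [I [[sI nI] minI]] := @artin_min (fun A => submod A /\ ~ noetherian A) setT
  (fun A => @proj1 _ _) (conj (submodT _) nk).
have ltI J : submod J -> (J `<=` I)%classic -> J <> I -> noetherian J.
  by move=> sJ JI neq; apply: contrapT => nJ; apply: neq; apply: minI.
have IP x a : I x -> I (a * x) by case: sI => _ _ IZ; apply: IZ.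
have dich a : (scalek _ a @` I = I)%classic \/ forall x, I x -> a * x = 0.
  have [->|neq] := pselect (scalek _ a @` I = I)%classic; [by left|right].
  pose K := (I `&` [set x : k^o | scalek _ a x = 0])%classic.
  have [KI x Ix|KI] := pselect (K = I); first by have [] : K x by rewrite KI.
  case: nI; apply: (noeth_ext (f := scalek _ a)) => //.
    by apply: ltI KI; [apply: submodI sI (submod_ker _)|apply: subIsetl].
  apply: ltI neq; first exact: submod_image.
  by move=> _ [x Ix <-]; apply: IP.
pose P : set k := [set a | forall x, I x -> a * x = 0]%classic.
have primeP a b : P (a * b) -> P a \/ P b.
  move=> Pab; case: (dich a) => [aI|]; [right|by left].
  by move=> x; rewrite -{1}aI => -[y Iy <-]; rewrite /= mulrCA mulrA Pab.
have P0 : P 0 by move=> x _; rewrite mul0r.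
have nfgI : ~ fg I.
  move=> fgI; apply: nI => T sT TI; have [->//|TnI] := pselect (T = I).
  by have /(_ T) := ltI T sT TI TnI; apply.
have [v [Iv v0]] : exists v, I v /\ v <> 0.
  apply: contrapT => nv; apply: nfgI; exists [::]; apply/seteqP; split=> x /=.
    by move=> Ix; apply: contrapT => x0; apply: nv; exists x.
  by move=> ->; case: sI.
have [|C [sC _ Cv maxC]] :=
    @max_disjoint _ k^o [set 0]%classic (span [:: v : k^o]) (submod_set0 _).
  by move=> x.
have vv : span [:: v : k^o] v by apply: mem_span; rewrite inE.
have [t et] : fg (I `&` C)%classic.
  apply: noeth_fg (submodI sI sC) _; apply: ltI (submodI sI sC) _ _.
    exact: subIsetl.
  move=> e; have [_ Cvv] : (I `&` C)%classic v by rewrite e.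
  by apply: v0; apply: Cv.
apply: nfgI; exists ([:: v] ++ t); apply/seteqP; split; last first.
  apply: span_sub => // x; rewrite mem_cat inE => /orP[/eqP->//|/mem_span].
  by rewrite -et => -[].
move=> x Ix; apply/span_cat; rewrite -et.
have [Cx|nCx] := pselect (C x).
  by exists 0, x; rewrite add0r; split=> //; case: (submod_span [:: v : k^o]).
have [c [a [Cc Sv nz]]] := maxC x nCx.
have [|d dP] := @artin_inv P a primeP P0.
  move=> /(_ x Ix) ax; apply: nz; apply: Cv => //.
  by rewrite -[a *: x]/(a * x) ax addr0.
have dax : d * a * x = x.
  by apply/esym/eqP; rewrite -subr_eq0 -{1}[x]mul1r -mulrBl; apply/eqP/dP.
exists (d *: (c + a *: x)), (- (d *: c)); split.
- by case: (submod_span [:: v : k^o]) => _ _; apply.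
- split; last by apply: (submodN sC); case: sC => _ _; apply.
  have -> : - (d *: c) = x - d *: (c + a *: x).
    by rewrite scalerDr opprD [d *: (a *: x)]mulrA dax addrCA subrr addr0.
  apply: (submodB sI Ix); case: (sI) => _ _ IZ; apply: IZ.
  move: Sv; apply: span_sub => //.
  by move=> y; rewrite inE => /eqP->.
- by rewrite scalerDr addrAC subrr add0r [d *: (a *: x)]mulrA dax.
Qed.

(** An essential extension E of N is no bigger than N where a prime ideal acts
    by zero: there a e in N with a e nonzero gives e in N, since a is invertible
    modulo the ideal.  In general consider a maximal ideal A such that the
    elements of E killed by A do not form a noetherian module.  If A contains
    ab but neither a nor b, multiplication by a has its kernel killed by A + (a)
    and its image by A + (b), contrary to maximality. *)
Lemma essential_noeth (X : lmodType k) (N E : set X) :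
  submod E -> noetherian N -> submod N ->
  (forall e, E e -> e <> 0 -> exists a, N (a *: e) /\ a *: e <> 0) -> noetherian E.
Proof.
move=> sE nN sN ess.
pose ann (A : set k^o) : set X :=
  (E `&` [set x | forall a, A a -> a *: x = 0])%classic.
have sann A : submod (ann A).
  apply: submodI sE _; split=> [a _|x y Ax Ay a Aa|b x Ax a Aa].
  - exact: scaler0.
  - by rewrite scalerDr Ax // Ay // addr0.
  - by rewrite scalerA mulrC -scalerA Ax // scaler0.
suff allA A : submod A -> noetherian (ann A).
  apply: noeth_sub (allA [set 0]%classic (submod_set0 _)) => x Ex; split=> //.
  by move=> a ->; rewrite scale0r.
move=> sA; apply: contrapT => nA.
have [{nA sA}A [[sA nA] maxA]] :=
  noeth_max (F := fun A => submod A /\ ~ noetherian (ann A)) artinian_noeth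
  (fun A => @proj1 _ _) (conj sA nA).
pose adj (b : k) : set k^o := [set z | exists x c, A x /\ z = x + c * b]%classic.
have adjP b : ~ A b -> noetherian (ann (adj b)).
  move=> nAb; apply: contrapT => nB; case: (sA) => A0 AD AZ.
  have : adj b = A.
    apply: maxA; last by move=> x Ax; exists x, 0; rewrite mul0r addr0.
    split=> //; split=> [|_ _ [x [c [Ax ->]]] [y [d [Ay ->]]]|e _ [x [c [Ax ->]]]].
    + by exists 0, 0; rewrite mul0r addr0.
    + by exists (x + y), (c + d); rewrite mulrDl addrACA; split=> //; apply: AD.
    + exists (e *: x), (e * c); split; first exact: AZ.
      by rewrite scalerDr -mulrA.
  by move=> e; apply: nAb; rewrite -e; exists 0, 1; rewrite mul1r add0r.
have [[a [b [Aab nAa nAb]]]|prime] :=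
  pselect (exists a b, [/\ A (a * b), ~ A a & ~ A b]).
  apply: nA; apply: (noeth_ext (f := scalek X a)) => //.
    apply: noeth_sub (adjP a nAa) => x [[Ex Ax] ax]; split=> // _ [y [c [Ay ->]]].
    by rewrite scalerDl -scalerA [a *: x]ax scaler0 addr0 Ax.
  apply: noeth_sub (adjP b nAb) => _ [x [Ex Ax] <-]; split.
    by case: sE => _ _; apply.
  move=> _ [y [c [Ay ->]]]; rewrite scalerDl /=.
  have -> : y *: (a *: x) = 0 by rewrite scalerA mulrC -scalerA Ax // scaler0.
  by rewrite scalerA -mulrA [b * a]mulrC -scalerA Ax // scaler0 addr0.
apply: nA; apply: noeth_sub nN => x [Ex Ax].
have [->|x0] := pselect (x = 0); first by case: sN.
have [c [Nc c0]] := ess x Ex x0.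
have [||| d dP] := @artin_inv A c.
- move=> a b Aab; apply: contrapT => /not_orP[nAa nAb].
  by apply: prime; exists a, b.
- by case: sA.
- by move=> Ac; apply: c0; apply: Ax.
suff -> : x = d *: (c *: x) by case: sN => _ _; apply.
apply/eqP; rewrite -subr_eq0 scalerA -{1}[x]scale1r -scalerBl; apply/eqP.
exact: Ax.
Qed.

End Artinian.

(** * Restriction of scalars and coinduction *)

(** An alias of X that carries the k-module structure; phi is an argument so
    that this structure can be found from the type. *)
Definition restr (k R : pzRingType) (phi : {rmorphism k -> R}) (X : lmodType R)
  : Type := X.

Section RestrictScalars.
Variables (k R : pzRingType) (phi : {rmorphism k -> R}).

Section Structure.
Variable X : lmodType R.
HB.instance Definition _ := GRing.Zmodule.on (restr phi X).

Definition restr_scale (a : k) (x : restr phi X) : restr phi X := phi a *: (x : X).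

Fact restr_scaleA a b x : restr_scale a (restr_scale b x) = restr_scale (a * b) x.
Proof. by rewrite /restr_scale scalerA rmorphM. Qed.
Fact restr_scale1 : left_id 1 restr_scale.
Proof. by move=> x; rewrite /restr_scale rmorph1 scale1r. Qed.
Fact restr_scaleDr : right_distributive restr_scale +%R.
Proof. by move=> a x y; apply: scalerDr. Qed.
Fact restr_scaleDl x : {morph restr_scale^~ x : a b / a + b}.
Proof. by move=> a b; rewrite /restr_scale rmorphD scalerDl. Qed.

HB.instance Definition _ := GRing.Zmodule_isLmodule.Build k (restr phi X)
  restr_scaleA restr_scale1 restr_scaleDr restr_scaleDl.
End Structure.

Section Map.
Variables (X Y : lmodType R) (f : {linear X -> Y}).
Fact restr_mapZ (a : k) (x : restr phi X) :
  (f (a *: x) : restr phi Y) = a *: (f x : restr phi Y).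
Proof. exact: linearZ_LR. Qed.
Definition restr_map : {linear restr phi X -> restr phi Y} :=
  linear_of (X := restr phi X) (Y := restr phi Y) (linearD f) restr_mapZ.
End Map.

Lemma submod_restr (X : lmodType R) (P : set X) :
  submod P -> submod (P : set (restr phi X)).
Proof. by case=> P0 PD PZ; split=> // a x; apply: PZ. Qed.

Lemma restr_fg (X : lmodType R) (P : set X) : submod P ->
  fg (P : set (restr phi X)) -> fg P.
Proof.
move=> sP [s es]; exists s; apply/seteqP; split.
  rewrite es; apply: (@span_sub k (restr phi X) s (span (s : seq X))).
    exact/submod_restr/submod_span.
  by move=> x /(@mem_span R X).
apply: span_sub => // x /(@mem_span k (restr phi X)).
by rewrite -es.
Qed.

Lemma restr_noeth (X : lmodType R) (P : set X) :
  noetherian (P : set (restr phi X)) -> noetherian P.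
Proof. by move=> nP T sT TP; apply/restr_fg/nP => //; apply: submod_restr. Qed.

(** The R-module structure of Hom_k(R, J) is (s h)(r) = h(r s). *)
Definition coind (J : lmodType k) : Type := Hom (restr phi R^o) J.

Section Coinduced.
Variable J : lmodType k.
HB.instance Definition _ := GRing.Zmodule.on (coind J).

Fact coind_scale_fD (s : R) (h : coind J) :
  {morph (fun r : restr phi R^o => h (r * s)) : x y / x + y}.
Proof. by move=> x y; rewrite [_ * s]mulrDl linearD. Qed.
Fact coind_scale_fZ (s : R) (h : coind J) a (x : restr phi R^o) :
  h ((a *: x : R) * s) = a *: h (x * s).
Proof. by rewrite -linearZ_LR /=; congr (h _); rewrite -[LHS]mulrA. Qed.

Definition coind_scale (s : R) (h : coind J) : coind J :=
  linear_of (coind_scale_fD s h) (coind_scale_fZ s h).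

Fact coind_scaleA r s h : coind_scale r (coind_scale s h) = coind_scale (r * s) h.
Proof. by apply: HomP => x /=; rewrite mulrA. Qed.
Fact coind_scale1 : left_id 1 coind_scale.
Proof. by move=> h; apply: HomP => x /=; rewrite mulr1. Qed.
Fact coind_scaleDr : right_distributive coind_scale +%R.
Proof. by move=> r f g; apply: HomP. Qed.
Fact coind_scaleDl h : {morph coind_scale^~ h : r s / r + s}.
Proof.
by move=> r s; apply: HomP => x /=; rewrite [X in h X]mulrDr; apply: linearD.
Qed.

HB.instance Definition _ := GRing.Zmodule_isLmodule.Build R (coind J)
  coind_scaleA coind_scale1 coind_scaleDr coind_scaleDl.

Section Adjunct.
Variables (X : lmodType R) (j : {linear restr phi X -> J}).

Fact coind_adj_fD x :
  {morph (fun r : restr phi R^o => j ((r : R) *: (x : X))) : r s / r + s}.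
Proof.
move=> r s; apply: etrans (linearD j _ _); congr (j _).
exact: (scalerDl (x : X) (r : R) (s : R)).
Qed.
Fact coind_adj_fZ x a (r : restr phi R^o) :
  j ((a *: r : R) *: (x : X)) = a *: j ((r : R) *: (x : X)).
Proof.
by apply: etrans (linearZ_LR j _ _); congr (j _);
   exact: (esym (scalerA (phi a) (r : R) (x : X))).
Qed.

Definition coind_adj_fun (x : X) : coind J :=
  linear_of (coind_adj_fD x) (coind_adj_fZ x).

Fact coind_adjD : {morph coind_adj_fun : x y / x + y}.
Proof.
move=> x y; apply: HomP => r; apply: etrans (linearD j _ _); congr (j _).
exact: (scalerDr (r : R) (x : X) (y : X)).
Qed.
Fact coind_adjZ s x : coind_adj_fun (s *: x) = s *: coind_adj_fun x.
Proof. by apply: HomP => r; exact: (congr1 j (scalerA (r : R) s x)). Qed.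

(** Coinduction is right adjoint to restriction: j corresponds to the map
    sending x to r |-> j (r x), and is recovered by evaluation at 1. *)
Definition coind_adj : {linear X -> coind J} := linear_of coind_adjD coind_adjZ.

Lemma coind_adjE x r : coind_adj x r = j (r *: x).
Proof. by []. Qed.

End Adjunct.

Lemma coind_adj_inj (X : lmodType R) (j : {linear restr phi X -> J}) :
  injective j -> injective (coind_adj j).
Proof.
move=> jI x y /(congr1 (fun h : coind J => h 1)).
by rewrite !coind_adjE !scale1r => /jI.
Qed.

(** By adjunction, extending a map to Hom_k(R, J) amounts to extending a k-linear
    map to J. *)
Lemma coind_injective : injective_module J -> injective_module (coind J).
Proof.
move=> injJ A B i f iI.
have f1D : {morph (fun a : restr phi A => f a 1) : x y / x + y}.
  by move=> x y; rewrite [f _]linearD.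
have f1Z a (x : restr phi A) : f (a *: x) 1 = a *: f x 1.
  apply: etrans (congr1 (fun h : coind J => h 1) (linearZ_LR f (phi a) x)) _.
  apply: etrans (linearZ_LR (f x) a 1); apply: (congr1 (f x)).
  exact: etrans (mul1r (phi a)) (esym (mulr1 (phi a))).
have [g gP] := injJ _ _ (restr_map i) (linear_of f1D f1Z) iI.
exists (coind_adj g) => x; apply: HomP => r.
apply: etrans (congr1 g (esym (linearZ_LR i (r : R) x))) _.
apply: etrans (gP (r *: x)) _.
apply: etrans (congr1 (fun h : coind J => h 1) (linearZ_LR f (r : R) x)) _.
exact: (congr1 (f x) (mul1r (r : R))).
Qed.

Hypothesis phi_central : forall a x, phi a * x = x * phi a.

Fact coind_evD (r : R) : {morph (fun h : restr phi (coind J) => h r) : x y / x + y}.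
Proof. by []. Qed.
Fact coind_evZ (r : R) a (h : restr phi (coind J)) :
  (a *: h : coind J) r = a *: (h : coind J) r.
Proof.
apply: etrans (linearZ_LR (h : coind J) a r).
exact: (congr1 (h : coind J) (esym (phi_central a r))).
Qed.
Definition coind_ev (r : R) : {linear restr phi (coind J) -> J} :=
  linear_of (coind_evD r) (coind_evZ r).

(** Evaluation at the generators of R embeds the coinduced module in a finite
    power of J. *)
Lemma coind_noeth (s : seq R) :
  [set: restr phi R^o]%classic = span (s : seq (restr phi R^o)) ->
  noetherian [set: J] -> noetherian [set: coind J].
Proof.
move=> Rs nJ; apply: restr_noeth.
pose K (t : seq R) : set (restr phi (coind J)) :=
  [set h | forall r, r \in t -> (h : coind J) r = 0]%classic.
have sK t : submod (K t).
  split=> [//|x y Kx Ky r rt|a x Kx r rt].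
    by rewrite /= Kx // Ky // addr0.
  by apply: etrans (coind_evZ r a x) _; rewrite Kx // scaler0.
have Kn t : noetherian (K t) -> noetherian [set: restr phi (coind J)].
  elim: t => [|r t IH] nK; first by apply: noeth_sub nK.
  apply: IH; apply: (noeth_ext (f := coind_ev r)) => //; last exact: noeth_sub nJ.
  apply: noeth_sub nK => h [Kh hr] u; rewrite inE => /predU1P[->//|].
  exact: Kh.
apply: (Kn s); apply: noeth_sub (@noeth_set0 _ _) => h Kh; apply: HomP => r /=.
have : span (s : seq (restr phi R^o)) r by rewrite -Rs.
move: r; apply: (@span_sub _ _ _ [set r | h r = 0]%classic); last exact: Kh.
exact: (submod_ker (h : {linear restr phi R^o -> J})).
Qed.

End Coinduced.
End RestrictScalars.

(** * Finitely generated injective modules over artin algebras *)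

(** C is a maximal submodule disjoint from N and E a maximal submodule
    containing N and disjoint from C.  Since Q is injective, the projection of
    E + C onto E along C extends to g : Q -> Q.  Maximality of C gives
    ker g = C, and maximality of E gives g(Q) = E, so E is a retract of Q. *)
Lemma injective_hull (R : pzRingType) (Q : lmodType R) (N : set Q) :
  injective_module Q -> submod N ->
  exists (E : set Q) (sE : submod E), [/\ (N `<=` E)%classic,
    injective_module (submodule sE) &
    forall e, E e -> e <> 0 -> exists a, N (a *: e) /\ a *: e <> 0].
Proof.
move=> injQ sN.
have [|C [sC _ CN maxC]] := @max_disjoint _ Q [set 0]%classic N (submod_set0 _).
  by move=> x.
have [|E [sE NE EC maxE]] := @max_disjoint _ Q N C sN.
  by move=> x Nx Cx; apply: CN.
exists E, sE; split=> //; last first.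
  move=> e Ee e0; have [|c [a [Cc Nn n0]]] := maxC e.
    by move=> Ce; apply: e0; apply: EC.
  suff c0 : c = 0 by exists a; move: Nn n0; rewrite c0 add0r.
  apply: EC => //; rewrite -[c](addrK (a *: e)); apply: (submodB sE).
    exact: NE.
  by case: (sE) => _ _; apply.
pose D : lmodType R := (submodule sE * submodule sC)%type.
have iD : {morph (fun u : D => incl sE u.1 + incl sC u.2) : x y / x + y}.
  move=> x y; apply: etrans (addrACA _ _ _ _).
  exact: (congr2 +%R (linearD (incl sE) x.1 y.1) (linearD (incl sC) x.2 y.2)).
have iZ a (u : D) :
    incl sE (a *: u).1 + incl sC (a *: u).2 =
    a *: (incl sE u.1 + incl sC u.2).
  apply: etrans (esym (scalerDr _ _ _)).
  exact: (congr2 +%R (linearZ_LR (incl sE) a u.1) (linearZ_LR (incl sC) a u.2)).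
have eD : {morph (fun u : D => incl sE u.1) : x y / x + y}.
  by move=> x y; exact: (linearD (incl sE) x.1 y.1).
have eZ a (u : D) : incl sE (a *: u).1 = a *: incl sE u.1.
  exact: (linearZ_LR (incl sE) a u.1).
have [|g gP] := injQ _ _ (linear_of iD iZ) (linear_of eD eZ).
  apply: raddf_inj => -[e c] ec0.
  have {}ec0 : incl sE e + incl sC c = 0 by exact: ec0.
  have e0 : incl sE e = 0.
    apply: EC; first exact: inclP.
    have -> : incl sE e = - incl sC c by apply/eqP; rewrite -addr_eq0 ec0.
    by apply: (submodN sC); exact: (inclP c).
  move: ec0; rewrite e0 add0r => c0.
  congr (_, _); apply: incl_inj.
    exact: etrans e0 (esym (linear0 (incl sE))).
  exact: etrans c0 (esym (linear0 (incl sC))).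
have gE e : E e -> g e = e.
  move=> Ee; have := gP (retr sE e, 0).
  change (g (incl sE (retr sE e) + incl sC 0) = incl sE (retr sE e) ->
    g e = e).
  by rewrite linear0 addr0 retrK.
have gC c : C c -> g c = 0.
  move=> Cc; have := gP (0, retr sC c).
  change (g (incl sE 0 + incl sC (retr sC c)) = incl sE 0 -> g c = 0).
  by rewrite linear0 add0r retrK.
have kerg x : g x = 0 -> C x.
  move=> gx; apply: contrapT => /maxC[c [a [Cc Nn]]]; apply.
  by rewrite -(gE _ (NE _ Nn)) linearD linearZ_LR /= gx gC // scaler0 addr0.
have gQ x : E (g x).
  apply: contrapT => /maxE[e [a [Ee Cw w0]]].
  have gw : g (e + a *: x) = e + a *: g x by rewrite linearD linearZ_LR /= gE.
  have [|c [b [Cc Nn n0]]] := maxC (e + a *: x).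
    by move/gC; rewrite gw.
  apply: n0; apply: CN (Nn); rewrite -(gE _ (NE _ Nn)).
  rewrite linearD linearZ_LR /= gw gC // add0r.
  by case: (sC) => _ _; apply.
move=> A B i f iI; have [h hP] := injQ _ _ i (incl sE \o f : {linear A -> Q}) iI.
have [h' h'P] := corestr sE (f := g \o h : {linear B -> Q}) (fun b => gQ (h b)).
exists h' => x; apply: incl_inj; rewrite h'P /=.
by rewrite [h _]hP /= gE //; apply: inclP.
Qed.

Section FinitelyGenerated.
Variables (k : pzRingType).

Lemma noeth_add (X : lmodType k) (P Q : set X) : submod P -> submod Q ->
  noetherian P -> noetherian Q ->
  noetherian [set z | exists x y, [/\ P x, Q y & z = x + y]]%classic.
Proof.
move=> sP sQ nP nQ; pose XX : lmodType k := (X * X)%type.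
have fD : {morph (fun u : XX => u.1) : u v / u + v} by [].
have fZ a (u : XX) : (a *: u).1 = a *: u.1 by [].
have aD : {morph (fun u : XX => u.1 + u.2) : u v / u + v}.
  by move=> u v; rewrite /= addrACA.
have aZ a (u : XX) : (a *: u).1 + (a *: u).2 = a *: (u.1 + u.2).
  by rewrite scalerDr.
have iD : {morph (fun y : X => (0, y) : XX) : u v / u + v}.
  by move=> u v; congr (_, _); rewrite addr0.
have iZ a (y : X) : ((0, a *: y) : XX) = a *: ((0, y) : XX).
  by congr (_, _); rewrite /= scaler0.
pose PQ : set XX := [set u | P u.1 /\ Q u.2]%classic.
have sPQ : submod PQ.
  case: sP sQ => P0 PD PZ [Q0 QD QZ]; split=> [//|x y [? ?] [? ?]|a x [? ?]].
    by split; [apply: PD|apply: QD].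
  by split; [apply: PZ|apply: QZ].
have nPQ : noetherian PQ.
  apply: (noeth_ext (f := linear_of fD fZ)) => //.
    apply: noeth_sub (noeth_image (f := linear_of iD iZ) sQ nQ).
    by move=> [x y] [[/= _ Qy] x0]; exists y; rewrite //= -x0.
  by apply: noeth_sub nP => _ [u [Pu _] <-].
apply: noeth_sub (noeth_image (f := linear_of aD aZ) sPQ nPQ).
by move=> _ [x [y [Px Qy ->]]]; exists (x, y).
Qed.

Lemma noeth_span (X : lmodType k) (s : seq X) :
  noetherian [set: k^o] -> noetherian (span s).
Proof.
move=> nk; elim: s => [|x s IH]; first exact: noeth_set0.
have fD : {morph (fun a : k^o => (a : k) *: x) : a b / a + b}.
  by move=> a b; apply: (scalerDl x (a : k) b).
have fZ a (b : k^o) : (a *: b : k) *: x = a *: ((b : k) *: x).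
  by apply/esym/(scalerA a (b : k) x).
pose f := linear_of fD fZ.
have nI := noeth_image (f := f) (submodT _) nk.
apply: noeth_sub (noeth_add (submod_image f (submodT _)) (submod_span s) nI IH).
by move=> _ [a [y [sy ->]]]; exists (a *: x), y; split=> //; exists a.
Qed.

Lemma restr_noeth_span (R : pzRingType) (phi : {rmorphism k -> R})
    (X : lmodType R) (s : seq X) :
  noetherian [set: restr phi R^o] -> noetherian (span s : set (restr phi X)).
Proof.
move=> nR; elim: s => [|x s IH]; first exact: noeth_set0.
have fD : {morph (fun a : restr phi R^o => (a : R) *: x : restr phi X) : a b / a + b}.
  by move=> a b; apply: (scalerDl x (a : R) b).
have fZ a (b : restr phi R^o) :
    ((a *: b : R) *: x : restr phi X) = a *: ((b : R) *: x : restr phi X).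
  by apply/esym/(scalerA (phi a) (b : R) x).
pose f := linear_of fD fZ.
have nI := noeth_image (f := f) (submodT _) nR.
apply: noeth_sub (noeth_add (submod_image f (submodT _))
  (submod_restr phi (submod_span s)) nI IH).
by move=> _ [a [y [sy ->]]]; exists (a *: x), y; split=> //; exists a.
Qed.

End FinitelyGenerated.

(** Evaluation at all characters embeds the abelian group X in a power of Q/Z,
    which is injective over the integers; coinduction to R turns this into an
    embedding of the module X. *)
Lemma enough_injectives (R : pzRingType) (X : lmodType R) :
  exists (Q : lmodType R) (j : {linear X -> Q}), injective_module Q /\ injective j.
Proof.
pose phi : {rmorphism int -> R} := intr.
pose D : lmodType int := char X -> zmodule QmodZ.
have jD : {morph (fun x : restr phi X => (fun g : char X => g (x : X)) : D) :
    x y / x + y}.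
  by move=> x y; apply/funext => g; apply: (raddfD g).
have jZ (n : int) (x : restr phi X) :
    (fun g : char X => g ((n *: x : restr phi X) : X)) =
    n *: ((fun g : char X => g (x : X)) : D).
  apply/funext => g; apply: etrans (congr1 g (scaler_int n (x : X))) _.
  by rewrite raddfMz -scalezrE.
have injD : injective_module D.
  move=> A B i f iI.
  have ext (g : char X) : exists h : {additive B -> QmodZ}, forall a, h (i a) = f a g.
    have fgA : zmod_morphism (fun a => f a g : QmodZ).
      by move=> x y; rewrite raddfB.
    apply: (@char_factor _ _ i (additive_of fgA)) => a.
    by rewrite -(raddf0 i) => /iI ->; rewrite raddf0.
  have [h hP] := choice ext.
  have hD : {morph (fun (b : B) => (fun g => h g b) : D) : x y / x + y}.
    by move=> x y; apply/funext => g; apply: (raddfD (h g)).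
  have hZ (n : int) (b : B) : (fun g => h g (n *: b)) = n *: ((fun g => h g b) : D).
    apply/funext => g; rewrite -[n in n *: b]intz scaler_int raddfMz.
    by rewrite -scalezrE.
  exists (linear_of hD hZ) => x; apply/funext => g; exact: hP.
exists (coind phi D), (coind_adj (linear_of jD jZ)); split.
  exact: coind_injective.
apply: coind_adj_inj; apply: raddf_inj => x jx.
apply: contrapT => /(@char_separates X)[g]; apply.
exact: (congr1 (fun h : D => h g) jx).
Qed.

Lemma noeth_subm (R : pzRingType) (X : lmodType R) (P : set X) (sP : submod P) :
  noetherian P -> noetherian [set: submodule sP].
Proof.
move=> nP; apply: (noeth_ext (f := incl sP)) => //.
  apply: noeth_sub (@noeth_set0 _ _) => u [_ /= u0].
  by apply: incl_inj; rewrite raddf0.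
by apply: noeth_sub nP => _ [u _ <-]; apply: inclP.
Qed.

(** J is an injective hull of X, which is noetherian because it is an essential
    extension. *)
Lemma artinian_embed (k : comPzRingType) (X : lmodType k) :
  artinian k -> noetherian [set: X] ->
  exists (J : lmodType k) (j : {linear X -> J}),
    [/\ injective_module J, noetherian [set: J] & injective j].
Proof.
move=> art nX; have [Q [j [injQ jI]]] := enough_injectives X.
have sN := submod_image j (submodT X).
have [E [sE [NE injE ess]]] := injective_hull injQ sN.
have nE := essential_noeth art sE (noeth_image (submodT X) nX) sN ess.
have [|j' j'P] := corestr sE (f := j); first by move=> x; apply: NE; exists x.
exists (submodule sE), j'; split=> //; first exact: noeth_subm.
by move=> x y /(congr1 (incl sE)); rewrite !j'P => /jI.
Qed.


Lemma module_finite_noeth (k : comPzRingType) (R : pzRingType)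
    (phi : {rmorphism k -> R}) (s : seq R) : artinian k ->
  (forall x, exists c : nat -> k, x = \sum_(i < size s) phi (c i) * s`_i) ->
  [set: restr phi R^o]%classic = span (s : seq (restr phi R^o)) /\
  noetherian [set: restr phi R^o].
Proof.
move=> art sP.
have Rs : [set: restr phi R^o]%classic = span (s : seq (restr phi R^o)).
  apply/seteqP; split=> // x _; have [c ->] := sP x.
  apply: submod_sum (submod_span _) _ => i.
  case: (submod_span (s : seq (restr phi R^o))) => _ _ sZ.
  by apply: (sZ (c i)); apply/mem_span/mem_nth.
by split=> //; rewrite Rs; apply/noeth_span/artinian_noeth.
Qed.

Lemma artin_algebra_noeth (R : pzRingType) :
  artin_algebra R -> noetherian [set: R^o].
Proof.
case=> k [phi [art _ [s sP]]]; have [_] := module_finite_noeth art sP.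
exact: (@restr_noeth _ _ phi R^o setT).
Qed.

(** Over k, the module N embeds in a finitely generated injective module J;
    hence it embeds over R in the injective module Hom_k(R, J), which is
    finitely generated over k. *)
Lemma artin_algebra_embed (R : pzRingType) (N : lmodType R) :
  artin_algebra R -> fg [set: N] ->
  exists (J : lmodType R) (j : {linear N -> J}),
    [/\ injective_module J, noetherian [set: J] & injective j].
Proof.
case=> k [phi [art central [s sP]]] [t et].
have [Rs nR] := module_finite_noeth art sP.
have nN : noetherian [set: restr phi N].
  by have := @restr_noeth_span _ _ phi _ t nR; rewrite -et.
have [J [j [injJ nJ jI]]] := artinian_embed art nN.
exists (coind phi J), (coind_adj j); split.
- exact: coind_injective.
- exact: (coind_noeth central Rs).
- exact: coind_adj_inj.
Qed.

(** * Tensor products and finitely generated submodules *)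

Section FiniteTensors.
Variables (R : pzRingType) (X : lmodType R^c) (Y : lmodType R).

Definition lin_on (X' : lmodType R^c) (P : set X) (rho : X -> X') : Prop :=
  (forall x y, P x -> P y -> rho (x + y) = rho x + rho y) /\
  (forall a x, P x -> rho (a *: x) = a *: rho x).

Lemma lin_on_sub (X' : lmodType R^c) (P Q : set X) (rho : X -> X') :
  (P `<=` Q)%classic -> lin_on Q rho -> lin_on P rho.
Proof.
move=> PQ [QD QZ]; split=> [x y /PQ Qx /PQ Qy|a x /PQ Qx]; first exact: QD.
exact: QZ.
Qed.

(** The map rho need not be linear: it will only be linear on the span of
    finitely many elements. *)
Definition tsum (X' : lmodType R^c) (rho : X -> X') (l : seq (X * Y)) : tens X' Y :=
  \sum_(p <- l) pure (rho p.1) p.2.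

Lemma tens_tsum (t : tens X Y) : exists l, t = tsum id l.
Proof.
have [u ->] : exists u, t = tens_pi u.
  by exists (repr (t : Quotient.quot (tens_relc X Y))); rewrite /tens_pi reprK.
have [_ pr _] := pure_balanced X Y.
exists [seq (p.1, p.2 *~ coeff p u) | p <- dom u].
rewrite -{1}[u]freeg_sumE raddf_sum /tsum [RHS]big_map.
apply: eq_bigr => -[x m] _ /=.
have -> : << coeff (x, m) u *g (x, m) >> =
    << (x, m) >> *~ coeff (x, m) u :> {freeg (X * Y) / int}.
  by rewrite freegU_mulz intz.
have pA : zmod_morphism (fun y : Y => pure x y : tens X Y).
  by apply: morphD_zmod => y z; rewrite pr.
by rewrite raddfMz -/(pure x m); apply/esym/(raddfMz (additive_of pA)).
Qed.

Fact tens_push_additive (X' : lmodType R^c) (rho : X -> X') : zmod_morphism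
  (fglift (fun p : X * Y => pure (rho p.1) p.2 : zmodule (tens X' Y))).
Proof. exact: lift_is_additive. Qed.

Definition tens_push (X' : lmodType R^c) (rho : X -> X') :
  {additive {freeg (X * Y) / int} -> tens X' Y} :=
  additive_of (tens_push_additive rho).

Lemma tens_pushU (X' : lmodType R^c) (rho : X -> X') p :
  tens_push rho << p >> = pure (rho p.1) p.2.
Proof. by case: p => x m; rewrite /= liftU scale1r. Qed.

(** A derivation of a relation mentions finitely many elements of X, so it
    survives any map that is linear on their span: tensor products commute
    with the direct limit of finitely generated submodules. *)
Lemma tens_rel_fin (u : {freeg (X * Y) / int}) : tens_rel u ->
  exists s : seq X, forall (X' : lmodType R^c) (rho : X -> X'),
    lin_on (span s) rho -> tens_push rho u = 0.
Proof.
elim=> [x y m|x m p|r x m||{}u v _ [s sP] _ [t tP]].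
- exists [:: x; y] => X' rho [rD _]; rewrite raddfB raddfD !tens_pushU /=.
  rewrite rD; try by apply: mem_span; rewrite !inE eqxx ?orbT.
  by have [pl _ _] := pure_balanced X' Y; rewrite pl subrr.
- exists [::] => X' rho _; rewrite raddfB raddfD !tens_pushU /=.
  by have [_ pr _] := pure_balanced X' Y; rewrite pr subrr.
- exists [:: x] => X' rho [_ rZ]; rewrite raddfB !tens_pushU /= rZ.
    by have [_ _ ps] := pure_balanced X' Y; rewrite ps subrr.
  by apply: mem_span; rewrite inE.
- by exists [::] => X' rho _; apply: raddf0.
exists (s ++ t) => X' rho rst; rewrite raddfB sP ?tP ?subr0 //.
  by apply: lin_on_sub rst; apply: span_mono => x; rewrite mem_cat orbC => ->.
by apply: lin_on_sub rst; apply: span_mono => x; rewrite mem_cat => ->.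
Qed.

Lemma tsum0_fin (l : seq (X * Y)) : tsum id l = 0 ->
  exists s : seq X, forall (X' : lmodType R^c) (rho : X -> X'),
    lin_on (span s) rho -> tsum rho l = 0.
Proof.
pose u : {freeg (X * Y) / int} := \sum_(p <- l) << p >>.
have ul : tsum id l = tens_pi u.
  by rewrite /u raddf_sum; apply: eq_bigr => -[x m].
rewrite ul -(raddf0 (@tens_pi _ X Y)) => /tens_pi_eq.
rewrite subr0 => /tens_rel_fin[s sP]; exists s => X' rho /sP <-.
by rewrite /u raddf_sum; apply: eq_bigr => p _; rewrite tens_pushU.
Qed.

End FiniteTensors.

Lemma tsum_map (R : pzRingType) (X X' : lmodType R^c) (Y Y' : lmodType R)
    (f : {linear X -> X'}) (g : {linear Y -> Y'}) (l : seq (X * Y)) :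
  tens_map f g (tsum id l) = tsum id [seq (f p.1, g p.2) | p <- l].
Proof.
rewrite /tsum raddf_sum big_map; apply: eq_bigr => p _.
exact: tens_map_pure.
Qed.

Lemma retr_lin_on (R : pzRingType) (X : lmodType R^c) (P : set X) (sP : submod P) :
  lin_on P (retr sP).
Proof. by split=> [x y|a x]; [apply: retrD|apply: retrZ]. Qed.

Lemma lin_on_comp (R : pzRingType) (X X' X'' : lmodType R^c) (P : set X)
    (rho : X -> X') (f : {linear X' -> X''}) :
  lin_on P rho -> lin_on P (f \o rho).
Proof.
by case=> rD rZ; split=> [x y Px Py|a x Px] /=; rewrite ?rD ?rZ ?linearD ?linearZ.
Qed.

(** A tensor over E lives over a finitely generated submodule of E, as does
    its vanishing in E tensor Z.  That submodule embeds in a finitely generated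
    injective J, and the inclusion extends to J because E is injective. *)
Lemma tens_kernel_lift (R : pzRingType) (E : lmodType R^c) (Y Z : lmodType R)
    (d : {linear Y -> Z}) (t : tens E Y) :
  artin_algebra R^c -> injective_module E ->
  tens_map (@idfun E : {linear E -> E}) d t = 0 ->
  exists (J : lmodType R^c) (h : {linear J -> E}) (t' : tens J Y),
    [/\ injective_module J, fg [set: J],
      tens_map h (@idfun Y : {linear Y -> Y}) t' = t &
      tens_map (@idfun J : {linear J -> J}) d t' = 0].
Proof.
move=> artR injE; have [l ->] := tens_tsum t; rewrite tsum_map.
move=> /tsum0_fin[s sP].
pose S := s ++ map fst l.
have sS := submod_span S; pose N := submodule sS.
have fgN : fg [set: N].
  apply: noeth_fg (submodT _) _; apply: noeth_subm.
  exact/noeth_span/artin_algebra_noeth.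
have [J [j [injJ nJ jI]]] := artin_algebra_embed artR fgN.
have [h hP] := injE _ _ j (incl sS) jI.
pose rho := j \o retr sS.
exists J, h, (tsum id [seq (rho p.1, p.2) | p <- l]); split=> //.
- exact: noeth_fg (submodT _) nJ.
- rewrite tsum_map /tsum !big_map; apply: eq_big_seq => p pl /=.
  rewrite [h _]hP (retrK sS) //.
  by apply: mem_span; rewrite mem_cat (map_f fst pl) orbT.
rewrite tsum_map /tsum !big_map.
have /sP : lin_on (span s) rho.
  apply: lin_on_comp; apply: lin_on_sub (retr_lin_on sS).
  by apply: span_mono => x; rewrite mem_cat => ->.
by rewrite /tsum big_map.
Qed.

(** * Hom and tensor product for finitely presented modules *)

Section DoubleOpposite.
Variable R : pzRingType.

(** The rings R^c^c and R have the same operations but are distinct structures,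
    so a module over one has to be declared as a module over the other. *)
Definition unop (A : lmodType R^c^c) : Type := A.
Definition reop (A : lmodType R) : Type := A.

Section Unop.
Variable A : lmodType R^c^c.
HB.instance Definition _ := GRing.Zmodule.on (unop A).
Definition unop_scale (r : R) (x : unop A) : unop A := (r : R^c^c) *: (x : A).
Fact unop_scaleA r s x : unop_scale r (unop_scale s x) = unop_scale (r * s) x.
Proof. exact: (scalerA (r : R^c^c) (s : R^c^c) (x : A)). Qed.
Fact unop_scale1 : left_id 1 unop_scale.
Proof. exact: (@scale1r R^c^c A). Qed.
Fact unop_scaleDr : right_distributive unop_scale +%R.
Proof. exact: (@scalerDr R^c^c A). Qed.
Fact unop_scaleDl x : {morph unop_scale^~ x : r s / r + s}.
Proof. exact: (@scalerDl R^c^c A x). Qed.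
HB.instance Definition _ := GRing.Zmodule_isLmodule.Build R (unop A)
  unop_scaleA unop_scale1 unop_scaleDr unop_scaleDl.
End Unop.

Section Reop.
Variable A : lmodType R.
HB.instance Definition _ := GRing.Zmodule.on (reop A).
Definition reop_scale (r : R^c^c) (x : reop A) : reop A := (r : R) *: (x : A).
Fact reop_scaleA r s x : reop_scale r (reop_scale s x) = reop_scale (r * s) x.
Proof. exact: (scalerA (r : R) (s : R) (x : A)). Qed.
Fact reop_scale1 : left_id 1 reop_scale.
Proof. exact: (@scale1r R A). Qed.
Fact reop_scaleDr : right_distributive reop_scale +%R.
Proof. exact: (@scalerDr R A). Qed.
Fact reop_scaleDl x : {morph reop_scale^~ x : r s / r + s}.
Proof. exact: (@scalerDl R A x). Qed.
HB.instance Definition _ := GRing.Zmodule_isLmodule.Build R^c^c (reop A)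
  reop_scaleA reop_scale1 reop_scaleDr reop_scaleDl.
End Reop.

Definition unop_map (A B : lmodType R^c^c) (f : {linear A -> B}) :
  {linear unop A -> unop B} :=
  linear_of (X := unop A) (Y := unop B) (linearD f)
    (fun r : R => linearZ_LR f (r : R^c^c)).

Definition reop_map (A B : lmodType R) (f : {linear A -> B}) :
  {linear reop A -> reop B} :=
  linear_of (X := reop A) (Y := reop B) (linearD f)
    (fun r : R^c^c => linearZ_LR f (r : R)).

Lemma unop_injective (E : lmodType R^c^c) :
  injective_module E -> injective_module (unop E).
Proof.
move=> injE A B i f iI.
have [g gP] := injE (reop A) (reop B) (reop_map i)
  (linear_of (X := reop A) (Y := E) (linearD f)
    (fun r : R^c^c => linearZ_LR f (r : R))) iI.
by exists (linear_of (X := B) (Y := unop E) (linearD g)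
  (fun r : R => linearZ_LR g (r : R^c^c))).
Qed.

Lemma artin_algebra_op2 : artin_algebra R -> artin_algebra R^c^c.
Proof.
case=> k [phi [art central gen]].
pose psi : k -> R^c^c := phi.
have psiA : zmod_morphism psi := @raddfB _ _ phi.
have psiM : monoid_morphism psi := (rmorph1 phi, rmorphM phi).
pose Psi : {rmorphism k -> R^c^c} := HB.pack psi
  (GRing.isZmodMorphism.Build k R^c^c psi psiA)
  (GRing.isMonoidMorphism.Build k R^c^c psi psiM).
by exists k, Psi.
Qed.

End DoubleOpposite.

Lemma span_coef (R : pzRingType) (X : lmodType R) (s : seq X) x : span s x ->
  exists c : {ffun 'I_(size s) -> R^o}, x = \sum_i (c i : R) *: s`_i.
Proof.
elim: s x => [|y s IH] x /=.
  by move=> ->; exists [ffun=> 0]; rewrite big_ord0.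
case=> a [z [/IH[c ->] ->]].
exists [ffun i => if unlift ord0 i is Some j then c j else a].
rewrite big_ord_recl ffunE unlift_none; congr (_ + _).
by apply: eq_bigr => i _; rewrite ffunE liftK.
Qed.

Section FinitePresentation.
Variables (R : pzRingType) (X : lmodType R) (E : lmodType R^c^c).

(** The evaluation pairing: e tensor g sends h to g (h e). *)
Definition hom_ev (t : tens E (char X)) (h : Hom (unop E) X) : QmodZ :=
  tens_lift (fun e (g : char X) => g (h e)) t.

Lemma hom_ev_balanced (h : Hom (unop E) X) :
  balanced (fun (e : E) (g : char X) => g (h e)).
Proof.
split=> [e e' g|//|r e g]; first by rewrite -raddfD -(linearD h).
exact: (congr1 g (linearZ_LR h (r : R) (e : unop E))).
Qed.

Lemma hom_evE h e g : hom_ev (pure e g) h = g (h e).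
Proof. exact/tens_lift_pure/hom_ev_balanced. Qed.

Lemma hom_ev_addl h : zmod_morphism (hom_ev^~ h).
Proof. exact/tens_lift_additive/hom_ev_balanced. Qed.

Lemma hom_ev_addr t : zmod_morphism (hom_ev t).
Proof.
move=> f g; pose k : {additive tens E (char X) -> QmodZ} :=
  additive_of (hom_ev_addl f) \- additive_of (hom_ev_addl g).
suff e : additive_of (hom_ev_addl (f - g)) =1 k by apply: e.
by apply: tens_ext => e x; rewrite /= !hom_evE raddfB.
Qed.

Hypotheses (noethR : noetherian [set: R^c^c^o]) (fgE : fg [set: E]).

Lemma ffun_delta_sum (I : finType) (V : zmodType) (x : {ffun I -> V}) :
  x = \sum_j [ffun i => if i == j then x j else 0].
Proof.
apply/ffunP => i; rewrite sum_ffunE (bigD1 i) //= big1 ?addr0 ?ffunE ?eqxx //.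
by move=> j ji; rewrite ffunE eq_sym (negPf ji).
Qed.

(** E is finitely presented, so Hom(E, X) is the kernel of a map between finite
    powers of X; characters extend from and factor through such maps, and
    a character of X^q is a q-tuple of characters of X. *)
Lemma hom_perfect : perfect hom_ev.
Proof.
have [s es] := fgE; set q := size s.
pose W : lmodType R^c^c := {ffun 'I_q -> R^c^c^o}.
pose e (j : 'I_q) : E := s`_j.
have evD : {morph (fun c : W => \sum_j (c j : R^c^c) *: e j) : x y / x + y}.
  move=> x y; rewrite -big_split; apply: eq_bigr => j _ /=.
  by rewrite ffunE; apply: (scalerDl (e j) (x j : R^c^c) (y j)).
have evZ a (c : W) : \sum_j ((a *: c) j : R^c^c) *: e j =
    a *: \sum_j (c j : R^c^c) *: e j.
  rewrite scaler_sumr; apply: eq_bigr => j _.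
  by rewrite ffunE; apply/esym/(scalerA a (c j : R^c^c) (e j)).
pose ev := linear_of evD evZ.
have ev_surj u : exists c, ev c = u.
  have [|c ->] := @span_coef _ _ s u; first by rewrite -es.
  by exists c.
(* l lists generators of the relations between the generators e j *)
have [l el] : fg [set c : W | ev c = 0]%classic.
  have noethW : noetherian [set: W].
    pose D : seq W := [seq [ffun i => if i == j then 1 else 0] | j <- enum 'I_q].
    have nD : noetherian (span D) by apply: noeth_span; exact: noethR.
    apply: noeth_sub nD => c _.
    rewrite (ffun_delta_sum c); apply: submod_sum (submod_span D) _ => j.
    have -> : [ffun i => if i == j then c j else 0] =
        (c j : R^c^c) *: ([ffun i => if i == j then 1 else 0] : W).
      apply/ffunP => i; rewrite !ffunE; case: eqP => _.
        exact: (esym (mulr1 (c j : R^c^c))).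
      exact: (esym (mulr0 (c j : R^c^c))).
    have [_ _] := submod_span D; apply; apply: mem_span.
    by apply/mapP; exists j; rewrite ?mem_enum.
  exact: noethW (submod_ker ev) _.
set p := size l.
pose rel (c : W) (x : {ffun 'I_q -> X}) : X := \sum_j (c j : R) *: x j.
have relD x : {morph rel^~ x : c d / c + d}.
  move=> c d; rewrite /rel -big_split; apply: eq_bigr => j _ /=.
  by rewrite ffunE; apply: (scalerDl (x j) (c j : R) (d j)).
have relZ x (a : R) (c : W) : rel ((a : R^c^c) *: c) x = a *: rel c x.
  rewrite /rel scaler_sumr; apply: eq_bigr => j _.
  by rewrite ffunE; apply/esym/(scalerA a (c j : R) (x j)).
pose C (x : {ffun 'I_q -> X}) : {ffun 'I_p -> X} :=
  [ffun i => rel (nth 0 l (i : 'I_p)) x].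
have CD : zmod_morphism C.
  apply: morphD_zmod => x y; apply/ffunP => i; rewrite !ffunE /rel -big_split.
  by apply: eq_bigr => j _ /=; rewrite ffunE scalerDr.
(* homomorphisms E -> X are the solutions of C x = 0 *)
have mkhom (x : {ffun 'I_q -> X}) : C x = 0 ->
    exists h : Hom (unop E) X, forall j, h (e j) = x j.
  move=> Cx.
  have kerx c : ev c = 0 -> rel c x = 0.
    move=> c0; have : span l c by rewrite -el.
    move: c {c0}; apply: (@span_sub _ W l [set c | rel c x = 0]%classic).
      split=> [|c d /= cx dx|a c /= cx].
      + by rewrite /= /rel big1 // => j _; rewrite ffunE; apply: (scale0r (x j)).
      + by rewrite relD cx dx addr0.
      + by apply: etrans (relZ x a c) _; rewrite cx scaler0.
    move=> c cl /=; have il : (index c l < p)%N by rewrite index_mem.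
    by have /ffunP/(_ (Ordinal il)) := Cx; rewrite !ffunE /= nth_index.
  have relE c d : ev c = ev d -> rel c x = rel d x.
    move=> cd; apply/eqP; rewrite -subr_eq0; apply/eqP.
    pose rx := additive_of (morphD_zmod (relD x)).
    rewrite -[LHS](raddfB rx); apply: kerx.
    by rewrite linearB cd subrr.
  have [r rP] := choice ev_surj.
  have hD : {morph (fun u : unop E => rel (r u) x) : u v / u + v}.
    by move=> u v; rewrite -relD; apply: relE; rewrite linearD !rP.
  have hZ (a : R) (u : unop E) : rel (r (a *: u)) x = a *: rel (r u) x.
    by rewrite -relZ; apply: relE; rewrite [RHS]linearZ_LR !rP.
  exists (linear_of hD hZ) => j /=.
  pose dj : W := [ffun i => if i == j then 1 else 0].
  have -> : x j = rel dj x.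
    rewrite /rel (bigD1 j) //= big1 => [|i ij]; rewrite ffunE.
      by rewrite eqxx addr0 scale1r.
    by rewrite (negPf ij); apply: (scale0r (x i)).
  apply: relE; rewrite rP /= (bigD1 j) //= big1 => [|i ij]; rewrite ffunE.
    by rewrite eqxx addr0; apply/esym/(scale1r (e j)).
  by rewrite (negPf ij); apply: (scale0r (e i)).
(* the canonical injections of X in its powers *)
have deltaD m (j : 'I_m) :
    zmod_morphism
      (fun x : X => [ffun i => if i == j then x else 0] : {ffun 'I_m -> X}).
  by move=> x y; apply/ffunP => i; rewrite !ffunE; case: eqP; rewrite ?subr0.
pose delta m (j : 'I_m) := additive_of (deltaD m j).
have comp m (g : {additive {ffun 'I_m -> X} -> QmodZ}) x :
    g x = \sum_j (g \o delta m j : char X) (x j).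
  by rewrite {1}(ffun_delta_sum x) raddf_sum.
have [pl pr ps] := pure_balanced E (char X).
have pure_suml (I : Type) (r : seq I) (F : I -> E) (g : char X) :
    pure (\sum_(i <- r) F i) g = \sum_(i <- r) pure (F i) g.
  have A : zmod_morphism (fun u : E => pure u g).
    by apply: morphD_zmod => u v; rewrite pl.
  exact: (raddf_sum (additive_of A)).
have pure_sumr (I : Type) (r : seq I) (u : E) (F : I -> char X) :
    pure u (\sum_(i <- r) F i) = \sum_(i <- r) pure u (F i).
  have A : zmod_morphism (fun g : char X => pure u g).
    by apply: morphD_zmod => g h; rewrite pr.
  exact: (raddf_sum (additive_of A)).
have hom_ev_sum (g : 'I_q -> char X) h :
    hom_ev (\sum_j pure (e j) (g j)) h = \sum_j g j (h (e j)).
  rewrite -[LHS]/(additive_of (hom_ev_addl h) _) raddf_sum.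
  by apply: eq_bigr => j _; apply: hom_evE.
have tensP (t : tens E (char X)) :
    exists g : 'I_q -> char X, t = \sum_j pure (e j) (g j).
  have [L ->] := tens_tsum t; rewrite /tsum.
  elim: L => [|[u g] L [f IH]].
    exists (fun=> 0); rewrite big_nil big1 // => j _.
    by apply: (addrI (pure (e j) 0)); rewrite -pr !addr0.
  have [c uc] := ev_surj u; exists (fun j => (c j : R^c) *: g + f j).
  rewrite big_cons IH /= -uc pure_suml -big_split; apply: eq_bigr => j _ /=.
  by rewrite ps pr.
split; [exact: hom_ev_addl|exact: hom_ev_addr| |].
(* The functional x |-> sum_j f_j (x_j) vanishes on the kernel of C, so it is
   psi \o C: the f_j are combinations of characters ps_ i with the relations as
   coefficients, and the tensor t vanishes. *)
- move=> t t0; have [f tf] := tensP t.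
  have gD : zmod_morphism (fun x : {ffun 'I_q -> X} => \sum_j f j (x j)).
    move=> x y; rewrite -sumrB; apply: eq_bigr => j _.
    by rewrite !ffunE raddfB.
  have [x /mkhom[h hx]|psi psiP] := @char_factor _ _ (additive_of CD) (additive_of gD).
    apply: etrans (t0 h); rewrite tf hom_ev_sum /=; apply: eq_bigr => j _.
    by rewrite -hx.
  pose ps_ i : char X := psi \o delta p i.
  have fE j : f j = \sum_i ((nth 0 l (i : 'I_p) : W) j : R^c) *: ps_ i.
    apply: charP => x.
    have -> : f j x = \sum_i f i (delta q j x i).
      rewrite (bigD1 j) //= big1 => [|i ij]; rewrite ffunE ?eqxx ?addr0 //.
      by rewrite (negPf ij) raddf0.
    rewrite -[LHS]/(additive_of gD (delta q j x)) -psiP comp.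
    have evx : zmod_morphism (fun g : char X => g x) by [].
    rewrite -[RHS]/(additive_of evx _) raddf_sum; apply: eq_bigr => i _.
    apply: (congr1 (ps_ i)); rewrite ffunE /rel (bigD1 j) //= big1 => [|i' ij].
      by rewrite ffunE eqxx addr0.
    by rewrite ffunE (negPf ij); apply: scaler0.
  rewrite tf (eq_bigr (fun j => \sum_i
      pure (((nth 0 l (i : 'I_p) : W) j : R^c^c) *: e j) (ps_ i))); last first.
    by move=> j _; rewrite fE pure_sumr; apply: eq_bigr => i _; rewrite ps.
  rewrite exchange_big big1 //= => i _; rewrite -pure_suml.
  have -> : \sum_j ((nth 0 l i : W) j : R^c^c) *: e j = 0.
    have : (nth 0 l i : W) \in l by apply: mem_nth.
    by move/mem_span; rewrite -el.
  by apply: (addrI (pure 0 (ps_ i))); rewrite -pl !addr0.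
(* extend g from Hom(E, X) to X^q, and split it into its components *)
move=> g.
have iD : zmod_morphism
    (fun h : Hom (unop E) X => [ffun j => h (e j)] : {ffun 'I_q -> X}).
  by move=> f h; apply/ffunP => j; rewrite !ffunE.
have [h /ffunP h0|G GP] := @char_factor _ _ (additive_of iD) g.
  suff -> : h = 0 by apply: raddf0.
  apply: HomP => u; have [c <-] := ev_surj u.
  apply: etrans (raddf_sum h _ _ _) _; rewrite big1 // => j _.
  apply: etrans (linearZ_LR h (c j : R) (e j)) _.
  by have := h0 j; rewrite !ffunE => ->; rewrite scaler0.
exists (\sum_j pure (e j) (G \o delta q j : char X)) => h.
by rewrite hom_ev_sum -GP comp; apply: eq_bigr => j _; rewrite /= !ffunE.
Qed.

End FinitePresentation.

(** * Characters of injective modules *)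

Lemma Hom_map_additive (R : pzRingType) (E X Y : lmodType R) (f : {linear X -> Y}) :
  zmod_morphism (Hom_map (E := E) f).
Proof. by move=> g h; apply: HomP => x; rewrite /= raddfB. Qed.

Definition Hom_premap (R : pzRingType) (E E' X : lmodType R) (a : {linear E -> E'})
  (h : Hom E' X) : Hom E X := h \o a.

Lemma Hom_premap_additive (R : pzRingType) (E E' X : lmodType R)
  (a : {linear E -> E'}) : zmod_morphism (@Hom_premap R E E' X a).
Proof. by move=> g h; apply: HomP => x. Qed.

Lemma hom_ev_adjoint (R : pzRingType) (E : lmodType R^c^c) (X Y : lmodType R)
    (f : {linear X -> Y}) :
  adjoint (@hom_ev R X E) (@hom_ev R Y E) (Hom_map f)
    (tens_map idfun (char_lin f)).
Proof.
move=> t h; move: t.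
pose k : {additive tens E (char Y) -> QmodZ} :=
  additive_of (hom_ev_addl h) \o tens_map (@idfun E : {linear E -> E}) (char_lin f).
apply: (tens_ext (f := k) (g := additive_of (hom_ev_addl (Hom_map f h)))) => e g.
by rewrite /= tens_map_pure !hom_evE.
Qed.

Lemma hom_ev_adjointl (R : pzRingType) (E E' : lmodType R^c^c) (X : lmodType R)
    (a : {linear E -> E'}) :
  adjoint (@hom_ev R X E') (@hom_ev R X E) (Hom_premap (unop_map a))
    (tens_map a idfun).
Proof.
move=> t h; move: t.
pose k : {additive tens E (char X) -> QmodZ} :=
  additive_of (hom_ev_addl h) \o
  tens_map a (@idfun (char X) : {linear (char X : lmodType R^c) -> _}).
apply: (tens_ext (f := k)
  (g := additive_of (hom_ev_addl (Hom_premap (unop_map a) h)))).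
by move=> e g; rewrite /= tens_map_pure !hom_evE.
Qed.

Lemma pure0l (R : pzRingType) (X : lmodType R^c) (Y : lmodType R) (y : Y) :
  pure 0 y = 0 :> tens X Y.
Proof.
by have [pl _ _] := pure_balanced X Y; apply: (addrI (pure 0 y)); rewrite -pl !addr0.
Qed.

Lemma tens_map_natural (R : pzRingType) (E E' : lmodType R^c) (Y Z : lmodType R)
    (h : {linear E -> E'}) (f : {linear Y -> Z}) (t : tens E Y) :
  tens_map h (@idfun Z : {linear Z -> Z})
    (tens_map (@idfun E : {linear E -> E}) f t) =
  tens_map (@idfun E' : {linear E' -> E'}) f
    (tens_map h (@idfun Y : {linear Y -> Y}) t).
Proof.
have [l ->] := tens_tsum t; rewrite !tsum_map /tsum !big_map.
by apply: eq_bigr => p _.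
Qed.

(** On finitely generated modules, which are finitely presented here, tensoring
    with I^+ is dual to the exact functor Hom(-, I).  A tensor over B that dies
    over C comes from a finitely generated submodule B', and dies over
    a finitely generated submodule C' of C containing g(B'). *)
Lemma injective_char_flat (R : pzRingType) (I : lmodType R) :
  noetherian [set: R^c^c^o] -> injective_module I ->
  flat_module (char I : lmodType R^c).
Proof.
move=> noethR injI A B C f g ex t; split; last first.
  case=> w <-; have [l ->] := tens_tsum w.
  rewrite !tsum_map /tsum !big_map big1 // => p _ /=.
  suff -> : g (f p.1) = 0 by apply: pure0l.
  by apply/ex; exists p.1.
have [l ->] := tens_tsum t; rewrite tsum_map; set l' := map _ l.
move=> /tsum0_fin[s sP].
pose sC := submod_span (s ++ map fst l'); pose sB := submod_span (map fst l).
pose sA := submodI sB (submod_ker g).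
have fgsub (D : lmodType R^c^c) (P : set D) (sPD : submod P) u :
    (P `<=` span u)%classic -> fg [set: submodule sPD].
  move=> Pu; apply: noeth_fg (submodT _) _; apply: noeth_subm.
  by apply: noeth_sub Pu _; apply: noeth_span; exact: noethR.
have [|k kP] := corestr sB (f := incl sA); first by move=> y; case: (inclP y).
have [|g' g'P] := corestr sC (f := g \o incl sB).
  move=> y /=; have := inclP y; rewrite -/(incl sB y).
  have : submod (g @^-1` span (s ++ map fst l'))%classic by apply: submod_preim.
  move=> sg; apply: (span_sub sg) => b /mapP[p pl ->]; apply: mem_span.
  rewrite mem_cat; apply/orP; right; rewrite /l' -map_comp.
  by apply/mapP; exists p.
have exHom : exact_at (additive_of (@Hom_premap_additive _ _ _ I (unop_map g')))
    (additive_of (@Hom_premap_additive _ _ _ I (unop_map k))).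
  move=> h; split=> [hk|[h' <-]]; last first.
    apply: HomP => y; rewrite /= -[RHS](linear0 h'); congr (h' _).
    apply: (incl_inj (sP := sC)); apply: etrans (g'P (k y)) _.
    apply: etrans (congr1 g (kP y)) _.
    exact: etrans (inclP y).2 (esym (linear0 (incl sC))).
  have [b gb|h' h'P] := inj_factor (g := unop_map g') (h := h) injI; last first.
    by exists h'; apply: HomP => b; apply: h'P.
  have Kb : (span (map fst l) `&` [set x | g x = 0])%classic (incl sB b).
    split; first exact: inclP.
    by rewrite /= -[g _]g'P [g' b]gb linear0.
  have kb : k (retr sA (incl sB b)) = b.
    by apply: (incl_inj (sP := sB)); rewrite kP retrK.
  by rewrite -kb; apply: (congr1 (fun h : Hom _ _ => h _) hk).
have := exact_dual (hom_perfect I noethR (fgsub _ _ sC _ (fun _ => id)))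
  (hom_perfect I noethR (fgsub _ _ sB _ (fun _ => id)))
  (hom_perfect I noethR (fgsub _ _ sA _ (@subIsetl _ _ _)))
  (f := additive_of (@Hom_premap_additive _ _ _ I (unop_map g')))
  (g := additive_of (@Hom_premap_additive _ _ _ I (unop_map k)))
  (@hom_ev_adjointl _ _ _ I g') (@hom_ev_adjointl _ _ _ I k) exHom.
pose t' : tens (submodule sB) (char I) :=
  tsum id [seq (retr sB p.1, p.2) | p <- l].
move=> /(_ t')[exT _]; case: exT => [|w kw].
  rewrite tsum_map -[RHS](sP _ _ (lin_on_sub _ (retr_lin_on sC))); last first.
    by apply: span_mono => x; rewrite mem_cat => ->.
  rewrite /tsum /l' !big_map; apply: eq_big_seq => p pl /=.
  congr (pure _ _); apply: (incl_inj (sP := sC)).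
  have Bp : span (map fst l) p.1 by apply/mem_span/map_f.
  apply: etrans (g'P _) _; apply: etrans (congr1 g (retrK sB Bp)) _.
  rewrite retrK //; apply: mem_span; rewrite mem_cat -map_comp.
  by apply/orP; right; apply/mapP; exists p.
have {kw} : tens_map (incl sB) idfun (tens_map k idfun w) = tsum id l.
  rewrite kw /t' tsum_map /tsum !big_map; apply: eq_big_seq => p pl.
  have Bp : span (map fst l) p.1 by apply/mem_span/map_f.
  exact: (congr1 (fun b => pure b p.2) (retrK sB Bp)).
have [L ->] := tens_tsum w; rewrite !tsum_map => <-.
have pre (y : submodule sA) : exists a, f a = incl sA y.
  by apply/ex; case: (inclP y).
have [c cP] := choice pre.
exists (tsum id [seq (c p.1, p.2) | p <- L]).
rewrite tsum_map /tsum !big_map; apply: eq_bigr => p _.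
exact: (congr1 (fun b => pure b p.2) (etrans (cP p.1) (esym (kP p.1)))).
Qed.

Lemma tens_fg_lift (R : pzRingType) (E : lmodType R^c) (Y : lmodType R)
    (t : tens E Y) : artin_algebra R^c -> injective_module E ->
  exists (J : lmodType R^c) (h : {linear J -> E}) (t' : tens J Y),
    [/\ injective_module J, fg [set: J] &
      tens_map h (@idfun Y : {linear Y -> Y}) t' = t].
Proof.
move=> artR injE.
have [|J [h [t' [injJ fgJ ht _]]]] :=
    @tens_kernel_lift R E Y Y (\0 : {linear Y -> Y}) t artR injE.
  have [l ->] := tens_tsum t; rewrite tsum_map /tsum big_map big1 // => p _ /=.
  have [_ pr _] := pure_balanced E Y.
  by apply: (addrI (pure p.1 0)); rewrite -pr !addr0.
by exists J, h, t'.
Qed.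

Theorem SG_injective_char (R : pzRingType) (n : nat) (M : lmodType R) :
  artin_algebra R -> SG_injective n M -> SG_flat n (char M : lmodType R^c).
Proof.
case: n => // m artR [J [d [p [injJ ex exE]]]].
have artR2 := artin_algebra_op2 artR.
have noethR := artin_algebra_noeth artR2.
pose X i : lmodType R^c := char (augment M J i).
apply: (@SG_flat_intro _ m X (char_lin p) (fun i => char_lin (d i))).
- by move=> i im; apply: injective_char_flat noethR (injJ i im).
- exact: (exact_up_dual (char_perfect M) (fun i => char_perfect (augment M J i))
    (@char_map_adjoint _ _ _ p) (fun i => @char_map_adjoint _ _ _ (d i)) ex).
move=> E injE.
(* for a finitely generated injective G the complex is dual to Hom(G, -) of the
   given one *)
have exG (G : lmodType R^c^c) : injective_module G -> fg [set: G] ->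
    exact_down (X := fun i => tens G (X i))
      (tens_map (@idfun G : {linear G -> G}) (char_lin p))
      (fun i => tens_map (@idfun G : {linear G -> G}) (char_lin (d i))).
  move=> injG fgG.
  apply: (exact_up_dual (hom_perfect M noethR fgG)
    (fun i => hom_perfect (augment M J i) noethR fgG)
    (p := additive_of (Hom_map_additive (E := unop G) p))
    (d := fun i => additive_of (Hom_map_additive (E := unop G) (d i)))
    (@hom_ev_adjoint _ G _ _ p) (fun i => @hom_ev_adjoint _ G _ _ (d i))).
  exact: exE (unop_injective injG).
have exact_lift (W Y Z : lmodType R^c) (u : {linear W -> Y}) (v : {linear Y -> Z}) :
    (forall G : lmodType R^c^c, injective_module G -> fg [set: G] ->
      exact_at (tens_map (@idfun G : {linear G -> G}) u)
               (tens_map (@idfun G : {linear G -> G}) v)) ->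
    exact_at (tens_map (@idfun E : {linear E -> E}) u)
             (tens_map (@idfun E : {linear E -> E}) v).
  move=> exuv t; split.
    case/(tens_kernel_lift artR2 injE) => G [h [t' [injG fgG <- t'0]]].
    have [w <-] := (exuv G injG fgG t').1 t'0.
    by exists (tens_map h idfun w); rewrite tens_map_natural.
  case=> w <-; have [G [h [w' [injG fgG <-]]]] := tens_fg_lift w artR2 injE.
  rewrite -!tens_map_natural.
  have -> : tens_map (@idfun G : {linear G -> G}) v
              (tens_map (@idfun G : {linear G -> G}) u w') = 0.
    by apply/(exuv G injG fgG); exists w'.
  exact: raddf0.
split.
- apply: raddf_inj => t.
  case/(tens_kernel_lift artR2 injE) => G [h [t' [injG fgG <- t'0]]].
  have [iI _ _ _] := exG G injG fgG.
  suff -> : t' = 0 by apply: raddf0.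
  by apply: iI; rewrite t'0 raddf0.
- by apply: exact_lift => G injG fgG; case: (exG G injG fgG).
- move=> i im; apply: exact_lift => G injG fgG.
  by case: (exG G injG fgG) => _ _ + _; apply.
move=> t; have [G [h [t' [injG fgG <-]]]] := tens_fg_lift t artR2 injE.
have [_ _ _ /(_ t')[x <-]] := exG G injG fgG.
by exists (tens_map h idfun x); rewrite tens_map_natural.
Qed.

Local Close Scope ring_scope.

Theorem proposition4p9 (R : pzRingType) (n : nat) (n_ge1 : 1 <= n) :
  (forall M : lmodType R, SG_flat n M -> SG_injective n (char M : lmodType R^c))
  /\
  (artin_algebra R -> forall M : lmodType R,
     SG_injective n M -> SG_flat n (char M : lmodType R^c)).
Proof.
split=> [M|artR M]; first exact: SG_flat_char.
exact: SG_injective_char.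
Qed.
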